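(* Let $n\geq 2$ and let $\lambda = (\lambda_{1}, \ldots, \lambda_{r}) \vdash n$ be a partition of $n$ (with $\lambda_1\ge\cdots\ge\lambda_r\ge 1$). Let $\eta_\lambda(1)$ be the eigenvalue of the $1$-point fixing graph $\mathcal{F}(n,1)$ indexed by $\lambda$. Then: (a) $\eta_\lambda (1)=0$ if and only if $\lambda= (n-1,1)$ or $\lambda=(2,1^{n-2})$. (b) If $r=1$ and $\lambda\neq (2)$, then $\eta_\lambda (1)>0$. (c) If $r\geq 2$ and $\lambda$ is neither $(n-1,1)$ nor $(2,1^{n-2})$, then $$\operatorname{sign}(\eta_{\lambda}(1)) = (-1)^{|\lambda|-\lambda_{1}-1} = (-1)^{(\#\text{ cells under the first row of }\lambda)-1},$$ where $\operatorname{sign}(\eta_\lambda(1))$ is $1$ if $\eta_{\lambda}(1)$ is positive and $-1$ if $\eta_{\lambda}(1)$ is negative.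
   Context: $\mathcal{S}_n$ is the symmetric group on $[n]=\{1,\dots,n\}$. For $0\le k<n$, $\mathcal{S}(n,k)$ is the set of all $\sigma\in\mathcal{S}_n$ fixing exactly $k$ points. The $k$-point fixing graph $\mathcal{F}(n,k)$ is the Cayley graph $\Gamma(\mathcal{S}_n,\mathcal{S}(n,k))$: its vertex set is $\mathcal{S}_n$, and $g,h$ are adjacent iff $gh^{-1}$ fixes exactly $k$ points. For $\lambda\vdash n$, let $\chi_\lambda$ be the irreducible (complex) character of $\mathcal{S}_n$ indexed by $\lambda$ in the standard way (so $\chi_{(n)}$ is the trivial character). Since $\mathcal{S}(n,k)$ is closed under conjugation, the eigenvalues of $\mathcal{F}(n,k)$ are indexed by partitions $\lambda\vdash n$ and are the integers $$\eta_\lambda(k)=\frac{1}{\chi_\lambda(1)}\sum_{\sigma\in\mathcal{S}(n,k)}\chi_\lambda(\sigma).$$ An exponent in a partition denotes multiplicity of a part, e.g. $(2,1^{n-2})$ has one part $2$ and $n-2$ parts equal to $1$. $|\lambda|=n$ is the size of $\lambda$; cells refer to boxes of the Ferrers diagram of $\lambda$. *)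

(* Defs.v *)
From mathcomp Require Import all_boot all_order all_algebra all_fingroup.
From mathcomp Require Import all_solvable all_field all_character.

Set Implicit Arguments.
Unset Strict Implicit.
Unset Printing Implicit Defensive.

Import Order.TTheory GRing.Theory Num.Theory.
Local Open Scope ring_scope.

(* Partitions are lists of positive parts in weakly decreasing order. *)
Definition is_partition (n : nat) (lam : seq nat) : bool :=
  [&& sorted geq lam, 0%N \notin lam & sumn lam == n].

(* The cells (row, column) of the Ferrers diagram; both coordinates start
   at 0, so the first row is row 0. *)
Definition ferrers (lam : seq nat) : seq (nat * nat) :=
  [seq (i, j) | i <- iota 0 (size lam), j <- iota 0 (nth 0%N lam i)].

Definition cells_under_first_row (lam : seq nat) : nat :=
  count (fun c : nat * nat => 0 < c.1)%N (ferrers lam).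

Section SymmetricCharacters.
Variables (n : nat) (lam : seq nat).

Local Notation G := [set: 'S_n]%G.
Local Notation aG := (regular_repr algC G).

(* The symmetric group acts on 'I_n = {0, ..., n-1}. The tableau of shape lam
   used here is the one filled with 0, ..., n-1 row by row from left to right:
   i lies in row (reshape_index lam i), column (reshape_offset lam i). *)
Definition row_stab : {set 'S_n} :=
  [set s : 'S_n | [forall i : 'I_n, reshape_index lam (s i) == reshape_index lam i]].

Definition col_stab : {set 'S_n} :=
  [set s : 'S_n | [forall i : 'I_n, reshape_offset lam (s i) == reshape_offset lam i]].

(* The Young symmetrizer, i.e. the element
     (\sum_(p in row_stab) p) (\sum_(q in col_stab) sgn(q) q)
   of the group algebra of 'S_n. The group algebra is the space of the regular
   representation, in which x : 'S_n is the basis row vector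
   delta_mx 0 (gring_index G x). *)
Definition young_symmetrizer : 'rV[algC]_#|G| :=
  \sum_(p in row_stab) \sum_(q in col_stab)
    (-1) ^+ odd_perm q *: delta_mx 0 (gring_index G (p * q)%g).

(* The Specht module: the right ideal of the group algebra generated by the
   Young symmetrizer. *)
Definition specht_repr :=
  submod_repr (cyclic_mx_module aG young_symmetrizer).

Definition chi : 'CF(G) := cfRepr specht_repr.

End SymmetricCharacters.

(* The connection set S(n, k) of the k-point fixing graph. *)
Definition fixing_perms (n k : nat) : {set 'S_n} :=
  [set s : 'S_n | #|[set i : 'I_n | s i == i]| == k].

(* The eigenvalue of the Cayley graph of 'S_n with connection set
   fixing_perms n k that is indexed by lam. *)
Definition eta (n : nat) (lam : seq nat) (k : nat) : algC :=
  (chi n lam 1%g)^-1 * \sum_(s in fixing_perms n k) chi n lam s.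

(* Num.sg is not used, because on algC it takes the value -1 also at numbers
   that are not real. Here only real numbers x have sign x = 1 or -1. *)
Definition sign (x : algC) : int :=
  if 0 < x then 1 else if x < 0 then -1 else 0.

(* Main.v *)
(* Write n = |lam|. Inclusion-exclusion over the fixed points gives
     sum_(s with one fixed point) chi_lam(s) = n! sum_j (-1)^j / j! f_(j+1),
   where f_j is the dimension of the subspace fixed by S_(n-j) in the Specht
   module, i.e. the multiplicity of the trivial character in the restriction of
   chi_lam to S_(n-j). By the branching rule f_j counts the ways of removing j
   boxes from lam so that at most one row is left. If lam = (L, nu) with
   |nu| = M > 0, this vanishes for j < M, and (-1)^(M-1) times the sum becomes an
   alternating sum b_0 - b_1 + ... + (-1)^L b_L of positive terms, which decrease
   except possibly between b_0 and b_1. Inequalities between the f_j, proved by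
   removing boxes, then show that it is positive outside the two exceptional
   shapes.
   The branching rule is proved by induction on n. Von Neumann's lemma gives the
   orthonormality of the Specht characters. If mu is contained in lam then
   chi_lam occurs in Ind chi_mu, by a positivity argument in the group algebra;
   and since Res (Ind phi) = phi + Ind (Res phi), the norm of Ind chi_mu is one
   more than the number of removable boxes of mu, which is the number of addable
   ones, so nothing else occurs in Ind chi_mu. *)
Require Import Defs.
From mathcomp Require Import all_boot all_order all_algebra all_fingroup.
From mathcomp Require Import all_solvable all_field all_character.
From mathcomp Require Import zify ring lra.
Import Order.TTheory GRing.Theory Num.Theory.
Local Open Scope ring_scope.

Set Implicit Arguments.
Unset Strict Implicit.
Unset Printing Implicit Defensive.

(** * Characters of right ideals *)

(** All groups S_m with m <= N are realised inside one ['S_N], as the permutations fixing the points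
    from m on, so that restriction, induction and all Young symmetrizers live in a single group
    algebra. This algebra is represented by the matrices of the regular representation: traces read
    off coefficients, and the conjugate transpose is the involution inverting group elements. A
    Young symmetrizer ab is not self-adjoint, but aba is, and it is still a multiple of an
    idempotent; up to a positive factor this makes the multiplicity of one Specht character in
    another a sum of squared norms, which is the positivity argument. Completeness of the Specht
    characters does not come from a count of conjugacy classes: it travels through the same
    induction as the branching rule. For lam = (L, nu), b_1 exceeds b_0 exactly when nu_1 < L; the
    loss must then be made up by b_2 - b_3, which is why four terms are estimated together. *)

Section IdealCharacter.

Variables (gT : finGroupType) (G : {group gT}).
Local Notation aG := (regular_repr algC G).

(** Writing [P] = XB with B a basis of [U], idempotence gives BX = 1, and the trace is cyclic. *)
Lemma mxtrace_submod_repr n (rG : mx_representation algC G n) (U P : 'M_n)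
    (Umod : mxmodule rG U) g :
  (P :=: U)%MS -> P *m P = P -> g \in G ->
  \tr (submod_repr Umod g) = \tr (P *m rG g).
Proof.
move=> PU PP Gg; set B := val_submod (1%:M : 'M_(\rank U)).
have /submxP[X PX] : (P <= B)%MS by rewrite PU val_submod1.
have /submxP[Y BY] : (B <= P)%MS by rewrite PU val_submod1.
have BX : B *m X = 1%:M.
  apply: (@val_submod_inj _ _ U).
  by rewrite val_submodE -/B -mulmxA -PX BY -mulmxA PP.
have BS : B *m rG g = submod_repr Umod g *m B.
  by rewrite -(val_submodJ Umod) // mul1mx val_submodE.
rewrite PX -mulmxA BS; move: (submod_repr Umod g) => S.
by rewrite mulmxA mxtrace_mulC mulmxA BX mul1mx.
Qed.

(* The idempotent matrix used here is the left multiplication by [k^-1 c] on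
   the group algebra, whose image is the right ideal generated by [c]. *)
Lemma ideal_char (c : gT -> algC) (k : algC) (u := \sum_(x in G)
    c x *: (delta_mx 0 (gring_index G x) : 'rV_#|G|)) g :
    k != 0 ->
    {in G, forall x, \sum_(y in G) c y * c (y^-1 * x)%g = k * c x} ->
    g \in G ->
  cfRepr (submod_repr (cyclic_mx_module aG u)) g =
    k^-1 * \sum_(y in G) c (y * g^-1 * y^-1)%g.
Proof.
move=> k0 cc Gg; rewrite cfunE Gg mulr1n.
pose L : 'M[algC]_#|G| := \matrix_(i, j) c (enum_val j * (enum_val i)^-1)%g.
have uE j : u 0 j = c (enum_val j).
  rewrite summxE (bigD1 (enum_val j)) ?enum_valP //= !mxE gring_valK !eqxx mulr1.
  rewrite big1 ?addr0 // => x /andP[Gx xj]; rewrite !mxE eqxx /=.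
  case: eqP => [jx|]; rewrite ?mulr0 //.
  by rewrite jx gring_indexK ?eqxx in xj.
have EL : enveloping_algebra_mx aG *m lin_mul_row u = L.
  apply/row_matrixP=> i; rewrite row_mul rowK mul_vec_lin_row /=.
  apply/rowP=> j; rewrite !mxE (bigD1 (gring_index G (enum_val j * (enum_val i)^-1)%g)) //=.
  rewrite uE gring_indexK ?groupM ?groupV ?enum_valP // !mxE.
  rewrite gring_indexK ?groupM ?groupV ?enum_valP // mulgKV gring_valK !eqxx mulr1.
  rewrite big1 ?addr0 // => l lj; rewrite !mxE eqxx /=.
  case: eqP => [jl|]; rewrite ?mulr0 //; case/eqP: lj.
  by rewrite jl gring_indexK ?groupM ?enum_valP // mulgK gring_valK.
have sumG (F : gT -> algC) : \sum_(i < #|G|) F (enum_val i) = \sum_(x in G) F x.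
  by rewrite [RHS]big_enum_val.
have LL : L *m L = k *: L.
  apply/matrixP=> i j; rewrite !mxE.
  under eq_bigr => l _ do rewrite !mxE.
  rewrite (sumG (fun x => c (x * (enum_val i)^-1)%g * c (enum_val j * x^-1)%g)).
  rewrite -cc ?groupM ?groupV ?enum_valP //.
  rewrite [RHS](reindex_inj (inj_comp (@mulgI _ (enum_val j)) (@invg_inj gT))) /=.
  rewrite [LHS](eq_bigl (fun x => (enum_val j * x^-1)%g \in G)); last first.
    by move=> x; rewrite groupMl ?groupV ?enum_valP.
  apply: eq_bigr => x _; rewrite mulrC; congr (_ * c _).
  by rewrite invMg invgK -!mulgA mulKg.
pose P := k^-1 *: L.
have PP : P *m P = P.
  by rewrite -scalemxAl -scalemxAr LL [k^-1 *: (k *: _)]scalerA mulVf // scale1r.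
rewrite (@mxtrace_submod_repr _ _ _ P) //; last first.
  apply: eqmx_trans (eqmx_sym (genmxE _)); rewrite EL.
  by apply: eqmx_scale; rewrite invr_eq0.
rewrite -scalemxAl mxtraceZ; congr (_ * _).
rewrite -(sumG (fun y => c (y * g^-1 * y^-1)%g)); apply: eq_bigr => i _.
rewrite mxE (bigD1 (gring_index G (enum_val i * g^-1)%g)) //= !mxE.
have Gig : (enum_val i * g^-1)%g \in G by rewrite groupM ?groupV ?enum_valP.
rewrite gring_indexK // mulgKV gring_valK !eqxx mulr1 big1 ?addr0 // => l.
rewrite !mxE eqxx /= => il; case: eqP => [jl|]; rewrite ?mulr0 //; case/eqP: il.
by rewrite jl gring_indexK ?groupM ?enum_valP // mulgK gring_valK.
Qed.

End IdealCharacter.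

(** * Young symmetrizers in the group algebra *)

Section GroupAlgebra.

Variable gT : finGroupType.

Definition rho (x : gT) := regular_repr algC [set: gT] x.

Lemma rho1 : rho 1%g = 1%:M.
Proof. exact: repr_mx1. Qed.

Lemma rhoM x y : rho (x * y)%g = rho x *m rho y.
Proof. by rewrite /rho repr_mxM ?inE. Qed.

Lemma rhoE x i j : rho x i j = (enum_val j == enum_val i * x)%g%:R.
Proof.
rewrite mxE /rho /= !mxE /= -(inj_eq (can_inj (@gring_valK gT [set: gT]%G))).
have [->|ne] := eqVneq (enum_val j) (enum_val i * x)%g.
  by rewrite gring_indexK ?inE ?eqxx.
by case: eqP => // jx; case/eqP: ne; rewrite jx gring_indexK ?inE.
Qed.

Lemma tr_rho x : \tr (rho x) = #|gT|%:R * (x == 1%g)%:R.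
Proof.
rewrite /mxtrace (eq_bigr (fun=> (x == 1%g)%:R)) => [|i _].
  by rewrite sumr_const card_ord /gcard cardsT mulr_natl.
by rewrite rhoE -{1}[enum_val i]mulg1 (inj_eq (mulgI _)) eq_sym.
Qed.

Definition adj n (A : 'M[algC]_n) := (map_mx Num.conj A)^T.

Lemma adj_rho x : adj (rho x) = rho x^-1%g.
Proof.
apply/matrixP=> i j; rewrite mxE mxE !rhoE rmorph_nat; congr ((nat_of_bool _)%:R).
by apply/idP/idP=> /eqP->; rewrite ?mulgK ?mulgKV.
Qed.

Lemma adjM n (A B : 'M_n) : adj (A *m B) = adj B *m adj A.
Proof. by rewrite /adj map_mxM trmx_mul. Qed.

Lemma adjZ n (k : algC) (A : 'M_n) : adj (k *: A) = k^* *: adj A.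
Proof. by rewrite /adj map_mxZ linearZ. Qed.

Lemma adj_sum n I r (P : pred I) (F : I -> 'M_n) :
  adj (\sum_(i <- r | P i) F i) = \sum_(i <- r | P i) adj (F i).
Proof. by rewrite /adj raddf_sum raddf_sum. Qed.

Lemma tr_mul_adj n (A : 'M_n) : \tr (A *m adj A) = \sum_i \sum_j `|A i j| ^+ 2.
Proof.
apply: eq_bigr => i _; rewrite mxE; apply: eq_bigr => j _.
by rewrite !mxE normCK.
Qed.

Lemma tr_mul_adj_ge0 n (A : 'M_n) : 0 <= \tr (A *m adj A).
Proof. by rewrite tr_mul_adj !sumr_ge0 // => i _; rewrite sumr_ge0 // => j _; rewrite exprn_ge0. Qed.

Lemma tr_mul_adj_gt0 n (A : 'M_n) : A != 0 -> 0 < \tr (A *m adj A).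
Proof.
move=> A0; rewrite lt_def tr_mul_adj_ge0 andbT; apply: contraNneq A0.
rewrite tr_mul_adj => /eqP; rewrite psumr_eq0 => [/allP A0|i _]; last first.
  by rewrite sumr_ge0 // => j _; rewrite exprn_ge0.
apply/eqP/matrixP=> i j; rewrite mxE.
have := A0 i (mem_index_enum _) => /=; rewrite psumr_eq0 => [/allP/(_ j (mem_index_enum _))/=|k _].
  by rewrite sqrf_eq0 normr_eq0 => /eqP.
by rewrite exprn_ge0.
Qed.

Lemma mulmx_sum2 (R : pzRingType) n (I J : finType) (P : pred I) (Q : pred J)
    (F : I -> J -> 'M[R]_n) (A B : 'M_n) :
  A *m (\sum_(i | P i) \sum_(j | Q j) F i j) *m B =
    \sum_(i | P i) \sum_(j | Q j) A *m F i j *m B.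
Proof.
rewrite mulmx_sumr mulmx_suml; apply: eq_bigr => i _.
by rewrite mulmx_sumr mulmx_suml.
Qed.

Lemma natr_card_neq0 : #|gT|%:R != 0 :> algC.
Proof. by rewrite pnatr_eq0 -lt0n; apply/card_gt0P; exists 1%g. Qed.

Lemma natr_card_gt0 : 0 < #|gT|%:R :> algC.
Proof. by rewrite lt_def natr_card_neq0 ler0n. Qed.

(** * Pairs of subgroups that behave like row and column stabilizers *)

Section YoungPair.

Variable odd : gT -> bool.
Hypothesis oddM : forall x y, odd (x * y)%g = odd x (+) odd y.
Local Notation sg x := ((-1) ^+ odd x : algC).

Let odd1 : odd 1%g = false.
Proof. by have := oddM 1 1; rewrite mulg1; case: odd. Qed.

Let oddV x : odd x^-1%g = odd x.
Proof. by have := oddM x x^-1; rewrite mulgV odd1; case: odd; case: odd. Qed.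

Let sgM x y : sg (x * y)%g = sg x * sg y.
Proof. by rewrite oddM signr_addb. Qed.

(* The abstract form of von Neumann's lemma on row and column stabilizers. *)
Definition young_pair (H R C : {group gT}) :=
  [/\ R \subset H, C \subset H, R :&: C = 1%g
    & forall x, x \in H -> x \in R * C \/
        exists t, [/\ t \in R, (t ^ x)%g \in C & odd t] ]%g.

Definition rsum (R : {group gT}) := \sum_(p in R) rho p.
Definition csum (C : {group gT}) := \sum_(q in C) sg q *: rho q.

(** The coefficient of [x] in the Young symmetrizer. The indicator avoids choosing a factorization
    of [x]; for a Young pair at most one term survives. *)
Definition ycoef (R C : {group gT}) (x : gT) : algC :=
  \sum_(p in R) \sum_(q in C) sg q * (x == p * q)%g%:R.

Definition young_elt R C := rsum R *m csum C.
(** The scalar kappa with c^2 = kappa c: expand the inner ba of a(ba)b into group elements x and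
    replace each a x b by its multiple of c. *)
Definition young_kappa (R C : {group gT}) :=
  \sum_(q in C) \sum_(p in R) sg q * ycoef R C (q * p)%g.

Lemma rsumMl (R : {group gT}) p : p \in R -> rho p *m rsum R = rsum R.
Proof.
move=> Rp; rewrite [RHS](reindex_inj (mulgI p)) mulmx_sumr /=.
by apply: eq_big => [x|x _]; rewrite ?groupMl ?rhoM.
Qed.

Lemma rsumMr (R : {group gT}) p : p \in R -> rsum R *m rho p = rsum R.
Proof.
move=> Rp; rewrite [RHS](reindex_inj (mulIg p)) mulmx_suml /=.
by apply: eq_big => [x|x _]; rewrite ?groupMr ?rhoM.
Qed.

Lemma csumMl (C : {group gT}) q : q \in C -> rho q *m csum C = sg q *: csum C.
Proof.
move=> Cq; rewrite [in RHS]/csum [in RHS](reindex_inj (mulgI q)) mulmx_sumr /=.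
rewrite scaler_sumr; apply: eq_big => [x|x _]; rewrite ?groupMl // -scalemxAr -rhoM.
by rewrite scalerA sgM mulrA -expr2 sqrr_sign mul1r.
Qed.

Lemma csumMr (C : {group gT}) q : q \in C -> csum C *m rho q = sg q *: csum C.
Proof.
move=> Cq; rewrite [in RHS]/csum [in RHS](reindex_inj (mulIg q)) mulmx_suml /=.
rewrite scaler_sumr; apply: eq_big => [x|x _]; rewrite ?groupMr // -scalemxAl -rhoM.
by rewrite scalerA sgM mulrCA -expr2 sqrr_sign mulr1.
Qed.

Lemma rsum_sub (R R' : {group gT}) :
  R \subset R' -> rsum R' *m rsum R = #|R|%:R *: rsum R'.
Proof.
move=> sRR'; rewrite mulmx_sumr (eq_bigr (fun=> rsum R')) => [|p Rp].
  by rewrite sumr_const scaler_nat.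
by rewrite rsumMr ?(subsetP sRR').
Qed.

Lemma adj_rsum R : adj (rsum R) = rsum R.
Proof.
rewrite adj_sum [RHS](reindex_inj invg_inj) /=.
by apply: eq_big => [x|x _]; rewrite ?groupV ?adj_rho.
Qed.

Lemma adj_csum C : adj (csum C) = csum C.
Proof.
rewrite adj_sum [RHS](reindex_inj invg_inj) /=.
apply: eq_big => [x|x _]; rewrite ?groupV // adjZ adj_rho oddV.
by rewrite rmorphXn rmorphN1.
Qed.

Lemma young_eltE (R C : {group gT}) :
  young_elt R C = \sum_x ycoef R C x *: rho x.
Proof.
rewrite /young_elt mulmx_suml.
under [RHS]eq_bigr => x _ do rewrite /ycoef scaler_suml.
rewrite exchange_big /=; apply: eq_bigr => p _.
under [RHS]eq_bigr => x _ do rewrite scaler_suml.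
rewrite exchange_big mulmx_sumr /=; apply: eq_bigr => q _.
rewrite (bigD1 (p * q)%g) //= eqxx mulr1 big1 ?addr0 => [|x /negPf->].
  by rewrite -scalemxAr rhoM.
by rewrite mulr0 scale0r.
Qed.

Lemma tr_young_elt R C x :
  \tr (young_elt R C *m rho x^-1%g) = #|gT|%:R * ycoef R C x.
Proof.
rewrite young_eltE mulmx_suml raddf_sum (bigD1 x) //= -scalemxAl -rhoM mulgV.
rewrite mxtraceZ tr_rho eqxx mulr1 mulrC big1 ?addr0 // => y yx.
by rewrite -scalemxAl -rhoM mxtraceZ tr_rho -eq_mulgV1 (negPf yx) !mulr0.
Qed.

(** The element [t] is absorbed on the left without a sign; carried past [x] it becomes [t ^ x] and
    is absorbed on the right with sign -1. So the product equals its own negative. *)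
Lemma rsum_rho_csum0 (R C : {group gT}) t x :
  t \in R -> (t ^ x)%g \in C -> odd t -> rsum R *m rho x *m csum C = 0.
Proof.
move=> Rt Ct ot; have tx : (t * x = x * t ^ x)%g by rewrite conjgE mulKVg.
have otx : odd (t ^ x)%g by rewrite conjgE !oddM oddV ot; case: (odd x).
have neg (A : 'M[algC]_#|[set: gT]|) : A = - A -> A = 0.
  move=> /eqP; rewrite -subr_eq0 opprK -mulr2n -scaler_nat scaler_eq0 pnatr_eq0.
  by move=> /eqP.
apply: neg; rewrite -{1}(rsumMr Rt) -[_ *m rho t *m _]mulmxA -rhoM tx rhoM.
by rewrite mulmxA -mulmxA csumMl // otx expr1 scaleN1r mulmxN.
Qed.

(** * Quasi-idempotence and positivity for one pair *)

Section OnePair.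

Variables H R C : {group gT}.
Hypothesis yp : young_pair H R C.
Local Notation a := (rsum R).
Local Notation b := (csum C).
Local Notation c := (young_elt R C).
Local Notation k := (young_kappa R C).
Local Notation s := (a *m b *m a).

Let sRH : R \subset H. Proof. by case: yp. Qed.
Let sCH : C \subset H. Proof. by case: yp. Qed.

Lemma ycoef_notin x : x \notin H -> ycoef R C x = 0.
Proof.
move=> nHx; apply: big1 => p Rp; apply: big1 => q Cq.
case: eqP => [xpq|]; rewrite ?mulr0 //; case/negP: nHx.
by rewrite xpq groupM //; [apply: (subsetP sRH)|apply: (subsetP sCH)].
Qed.

Lemma ycoef_prod p q : p \in R -> q \in C -> ycoef R C (p * q)%g = sg q.
Proof.
move=> Rp Cq; rewrite /ycoef (bigD1 p) //= (bigD1 q) //= eqxx mulr1 !big1 ?addr0 //.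
  move=> p' /andP[Rp' p'p]; apply: big1 => q' Cq'.
  case: eqP => [e|]; rewrite ?mulr0 //; case/eqP: p'p.
  have : (p'^-1 * p)%g \in R :&: C.
    rewrite inE groupM ?groupV //= -[p](mulgK q) e -!mulgA mulKg.
    by rewrite groupM ?groupV.
  case: yp => _ _ -> _ /set1P/eqP; rewrite -eq_mulVg1 => /eqP->//.
move=> q' /andP[Cq' q'q]; case: eqP => [/mulgI e|]; rewrite ?mulr0 //.
by rewrite e eqxx in q'q.
Qed.

(** Either x = p q and both factors are absorbed, or an odd [t] kills the product; in the second
    case [x] cannot lie in R C, so its coefficient is zero as well. *)
Lemma rsum_rho_csum x : x \in H -> a *m rho x *m b = ycoef R C x *: c.
Proof.
case: yp => _ _ _ /[apply] -[/mulsgP[p q Rp Cq ->]|[t [Rt Ct ot]]].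
  rewrite ycoef_prod // rhoM mulmxA rsumMr // -mulmxA csumMl //.
  by rewrite -scalemxAr.
rewrite (rsum_rho_csum0 Rt Ct ot).
suff -> : ycoef R C x = 0 by rewrite scale0r.
apply: big1 => p Rp; apply: big1 => q Cq.
case: eqP => [xpq|]; rewrite ?mulr0 //.
(* If x = p q, then [t ^ x] = [(t ^ p) ^ q] lies in C, hence so does [t ^ p]; it lies in R too, so t
   = 1, against its oddness. *)
suff : (t ^ p)%g \in R :&: C.
  case: yp => _ _ -> _ /set1P/eqP; rewrite -(conj1g p) (inj_eq (conjg_inj p)).
  by move/eqP=> t1; rewrite t1 odd1 in ot.
rewrite inE groupJ //= -(groupJr _ Cq) -conjgM -xpq //.
Qed.

(** The scalar by which c y c is a multiple of c; at y = 1 it is [young_kappa]. *)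
Definition young_coef y :=
  \sum_(q in C) \sum_(p in R) sg q * ycoef R C (q * y * p)%g.

Lemma csum_rho_rsum y :
  b *m rho y *m a = \sum_(q in C) \sum_(p in R) sg q *: rho (q * y * p)%g.
Proof.
rewrite /csum !mulmx_suml; apply: eq_bigr => q Cq.
rewrite mulmx_sumr; apply: eq_bigr => p Rp.
by rewrite -!scalemxAl !rhoM.
Qed.

Lemma young_elt_mid y : y \in H -> c *m rho y *m c = young_coef y *: c.
Proof.
move=> Hy; have -> : c *m rho y *m c = a *m (b *m rho y *m a) *m b.
  by rewrite /young_elt !mulmxA.
rewrite csum_rho_rsum mulmx_sum2 scaler_suml; apply: eq_bigr => q Cq.
rewrite scaler_suml; apply: eq_bigr => p Rp.
rewrite -scalemxAr -scalemxAl rsum_rho_csum ?scalerA //.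
by rewrite groupM ?groupM //; [apply: (subsetP sCH)|apply: (subsetP sRH)].
Qed.

Lemma young_elt_sqr : c *m c = k *: c.
Proof.
have := young_elt_mid (group1 H); rewrite rho1 mulmx1 => ->; congr (_ *: _).
by apply: eq_bigr => q _; apply: eq_bigr => p _; rewrite mulg1.
Qed.

Lemma tr_young_elt1 : \tr c = #|gT|%:R.
Proof.
have := tr_young_elt R C 1; rewrite invg1 rho1 mulmx1 => ->.
by rewrite -[1%g](mulg1) ycoef_prod // odd1 mulr1.
Qed.

(** The identity c^2 = kappa c read off coefficientwise, by taking the trace against [rho x^-1];
    this is the form that [ideal_char] asks for. *)
Lemma ycoef_conv : {in H, forall x,
  \sum_(y in H) ycoef R C y * ycoef R C (y^-1 * x)%g = k * ycoef R C x}.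
Proof.
move=> x Hx; apply: (mulfI natr_card_neq0).
rewrite [RHS]mulrCA -tr_young_elt -mxtraceZ scalemxAl -young_elt_sqr.
have -> : c *m c *m rho x^-1%g
  = \sum_y ycoef R C y *: (rho y *m c *m rho x^-1%g).
  rewrite {1}young_eltE !mulmx_suml; apply: eq_bigr => y _.
  by rewrite -!scalemxAl.
rewrite raddf_sum mulr_sumr big_mkcond /=; apply: eq_bigr => y _.
rewrite mxtraceZ -mulmxA mxtrace_mulC -mulmxA -rhoM.
have -> : (x^-1 * y = (y^-1 * x)^-1)%g by rewrite invMg invgK.
by rewrite tr_young_elt mulrCA; case: ifPn => // /ycoef_notin ->; rewrite mul0r.
Qed.

Lemma tr_sym_elt : \tr s = #|R|%:R * #|gT|%:R.
Proof.
rewrite mxtrace_mulC mulmxA (rsum_sub (subxx R)) -scalemxAl mxtraceZ; congr (_ * _).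
exact: tr_young_elt1.
Qed.

Lemma sym_elt_adj : adj s = s.
Proof. by rewrite !adjM adj_rsum adj_csum mulmxA. Qed.

Lemma sym_elt_sqr : s *m s = (#|R|%:R * k) *: s.
Proof.
rewrite -[a *m b](erefl c); have -> : c *m a *m (c *m a) = c *m (a *m a) *m b *m a.
  by rewrite /young_elt !mulmxA.
rewrite (rsum_sub (subxx R)) -scalemxAr -!scalemxAl -scalerA; congr (_ *: _).
by rewrite -(mulmxA c) -/(young_elt R C) young_elt_sqr -scalemxAl.
Qed.

Lemma tr_sym_elt_gt0 : 0 < \tr s.
Proof.
by rewrite tr_sym_elt mulr_gt0 ?natr_card_gt0 // ltr0n.
Qed.

Lemma sym_elt_neq0 : s != 0.
Proof. by apply: contraTneq tr_sym_elt_gt0 => ->; rewrite mxtrace0 ltxx. Qed.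

(** For the self-adjoint s = aba, the squared norm of s is the trace of s^2, which is |R| kappa
    times the positive trace of s. *)
Lemma young_kappa_gt0 : 0 < k.
Proof.
have R0 : 0 < #|R|%:R :> algC by rewrite ltr0n.
have T0 := natr_card_gt0.
have s0 := sym_elt_neq0.
have := tr_mul_adj_gt0 s0; rewrite sym_elt_adj sym_elt_sqr mxtraceZ tr_sym_elt.
by rewrite pmulr_lgt0 ?pmulr_rgt0 //; apply: mulr_gt0.
Qed.

(** Both sides are the factor of c in c c c: expand the middle c into group elements, or square
    twice. This becomes the norm of the character. *)
Lemma sum_ycoef_young_coef : \sum_(y in H) ycoef R C y * young_coef y = k ^+ 2.
Proof.
apply: (mulIf natr_card_neq0); rewrite -tr_young_elt1 -!mxtraceZ; congr (\tr _).
have <- : c *m c *m c = k ^+ 2 *: c.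
  by rewrite young_elt_sqr -scalemxAl young_elt_sqr scalerA.
have -> : c *m c *m c = \sum_y ycoef R C y *: (c *m rho y *m c).
  rewrite [X in _ *m X *m _]young_eltE mulmx_sumr mulmx_suml; apply: eq_bigr => y _.
  by rewrite -scalemxAr -scalemxAl.
rewrite scaler_suml big_mkcond /=; apply: eq_bigr => y _.
case: ifPn => [Hy|/ycoef_notin->]; last by rewrite scale0r.
by rewrite young_elt_mid // scalerA.
Qed.

End OnePair.

(** The construction behind [chi], with arbitrary subgroups in place of the full group and the two
    stabilizers. *)
Definition young_char (H R C : {group gT}) : 'CF(H) :=
  cfRepr (submod_repr (cyclic_mx_module (regular_repr algC H)
    (\sum_(p in R) \sum_(q in C) sg q *: delta_mx 0 (gring_index H (p * q)%g)))).

Lemma young_charE (H R C : {group gT}) g : young_pair H R C -> g \in H ->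
  young_char H R C g =
    (young_kappa R C)^-1 * \sum_(y in H) ycoef R C (y * g^-1 * y^-1)%g.
Proof.
move=> yp Hg; rewrite -ideal_char //; last first.
- exact: ycoef_conv.
- exact: lt0r_neq0 (young_kappa_gt0 yp).
rewrite /young_char; set u := \sum_(p in R) _; set v := \sum_(x in H) _.
suff -> : u = v by [].
rewrite /u /v; under [RHS]eq_bigr => x _ do rewrite /ycoef scaler_suml.
rewrite [RHS]exchange_big /=; apply: eq_bigr => p Rp.
under [RHS]eq_bigr => x _ do rewrite scaler_suml.
rewrite [RHS]exchange_big /=; apply: eq_bigr => q Cq.
have [sRH sCH _ _] := yp.
have Hpq : (p * q)%g \in H by rewrite groupM //; [apply: (subsetP sRH)|apply: (subsetP sCH)].
rewrite (bigD1 (p * q)%g) //= eqxx mulr1 big1 ?addr0 // => x /andP[_ /negPf->].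
by rewrite mulr0 scale0r.
Qed.

Lemma young_char_char H R C : young_char H R C \is a character.
Proof. exact: cfRepr_char. Qed.

(** The right side is the trace of the idempotent c / kappa in a representation affording [psi]; the
    average over conjugates in [young_charE] collapses because [psi] is a class function. *)
Lemma cfdot_young_char (H R C : {group gT}) (psi : 'CF(H)) :
    young_pair H R C -> psi \is a character ->
  '[young_char H R C, psi] =
    (young_kappa R C)^-1 * \sum_(x in H) ycoef R C x * psi x.
Proof.
move=> yp cpsi; rewrite cfdotE.
have -> : \sum_(x in H) young_char H R C x * (psi x)^* = \sum_(g in H)
   \sum_(y in H) (young_kappa R C)^-1 * (ycoef R C (y * g^-1 * y^-1)%g * psi g^-1%g).
  apply: eq_bigr => g Hg; rewrite young_charE // -char_inv // -mulrA mulr_suml.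
  by rewrite mulr_sumr.
rewrite exchange_big /= (eq_bigr (fun=> (young_kappa R C)^-1 *
  \sum_(x in H) ycoef R C x * psi x)) => [|y Hy].
  by rewrite sumr_const -[X in _ * X]mulr_natl mulKf // neq0CG.
rewrite -mulr_sumr; congr (_ * _).
rewrite [RHS](reindex_inj (conjg_inj y^-1%g)) /= [RHS](reindex_inj invg_inj) /=.
apply: eq_big => [g|g Hg]; first by rewrite groupJr ?groupV.
by rewrite cfunJ ?groupV // conjgE invgK mulgA.
Qed.

(** * Multiplicities between a group and a subgroup *)

Section TwoPairs.

Variables (H K R C R' C' : {group gT}).
Hypotheses (yp : young_pair H R C) (yp' : young_pair K R' C') (sHK : H \subset K).

Lemma cfdot_young_char_Res :
  '[young_char H R C, 'Res[H] (young_char K R' C')] =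
   (young_kappa R C * young_kappa R' C' * #|gT|%:R)^-1 *
   \sum_(y in K) \tr (young_elt R' C' *m rho y *m young_elt R C *m rho y^-1%g).
Proof.
rewrite cfdot_young_char ?cfRes_char ?young_char_char //.
rewrite !invfM -!mulrA; congr (_ * _).
have -> : \sum_(x in H) ycoef R C x * 'Res[H] (young_char K R' C') x
  = \sum_(x in H) \sum_(y in K) (young_kappa R' C')^-1 *
     (ycoef R C x * ycoef R' C' (y * x^-1 * y^-1)%g).
  apply: eq_bigr => x Hx; rewrite cfResE // young_charE ?(subsetP sHK) //.
  by rewrite mulrCA -mulr_sumr; congr (_ * _); rewrite mulr_sumr.
rewrite exchange_big /= !mulr_sumr; apply: eq_bigr => y Ky.
rewrite -mulr_sumr; congr (_ * _); apply: (mulfI natr_card_neq0).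
rewrite mulVKf ?natr_card_neq0 // [X in _ *m X *m _]young_eltE.
rewrite mulmx_sumr mulmx_suml raddf_sum mulr_sumr big_mkcond /=.
apply: eq_bigr => x _; rewrite -scalemxAr -scalemxAl mxtraceZ mulrCA.
do 2!rewrite -[young_elt R' C' *m _ *m _]mulmxA -rhoM.
rewrite -[(y * x * y^-1)%g]invgK tr_young_elt !invMg !invgK mulgA.
by case: ifPn => // /(ycoef_notin yp)->; rewrite mul0r.
Qed.

(** Since s and s' are self-adjoint with squares that are multiples of themselves, the trace of s' y
    s y^-1 is, up to the displayed factors, the squared norm of s' y s. *)
Lemma tr_sym_elt2 y :
  (#|R'|%:R * young_kappa R' C') * (#|R|%:R * young_kappa R C) *
  \tr (rsum R' *m csum C' *m rsum R' *m rho y *m (rsum R *m csum C *m rsum R) *m rho y^-1%g)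
  = \tr ((rsum R' *m csum C' *m rsum R' *m rho y *m (rsum R *m csum C *m rsum R)) *m
     adj (rsum R' *m csum C' *m rsum R' *m rho y *m (rsum R *m csum C *m rsum R))).
Proof.
rewrite !(adjM (_ *m rho y)) (adjM _ (rho y)) adj_rho !sym_elt_adj.
have := sym_elt_sqr yp; have := sym_elt_sqr yp'.
move: (_ *m _ *m rsum R) (_ *m _ *m rsum R') => s s' e' e.
have -> : s' *m rho y *m s *m (s *m (rho y^-1%g *m s'))
  = s' *m (rho y *m (s *m s) *m rho y^-1%g *m s') by rewrite !mulmxA.
rewrite e [RHS]mxtrace_mulC -[_ *m s' *m s']mulmxA e' -!scalemxAr -!scalemxAl.
by rewrite !mxtraceZ -[LHS]mulrA [in RHS]mxtrace_mulC !mulmxA.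
Qed.

(** Only the sums over [K] are compared: substituting y p^-1 for y and using p a = a appends p to
    ab, and averaging over p in R turns ab into aba. The same is done on the other side with R'. *)
Lemma sum_tr_young_sym :
  #|R|%:R * #|R'|%:R *
   \sum_(y in K) \tr (young_elt R' C' *m rho y *m young_elt R C *m rho y^-1%g)
  = \sum_(y in K) \tr (rsum R' *m csum C' *m rsum R' *m rho y *m
      (rsum R *m csum C *m rsum R) *m rho y^-1%g).
Proof.
have [sRH sCH _ _] := yp; have [sRK' sCK' _ _] := yp'.
have st1 (A B : 'M[algC]_#|[set: gT]|) :
    (forall p, p \in R -> rho p *m A = A) ->
    #|R|%:R * \sum_(y in K) \tr (B *m rho y *m A *m rho y^-1%g) =
    \sum_(y in K) \tr (B *m rho y *m (A *m rsum R) *m rho y^-1%g).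
  move=> pA; rewrite mulr_natl -sumr_const.
  have -> : \sum_(y in K) \tr (B *m rho y *m (A *m rsum R) *m rho y^-1%g) =
    \sum_(p in R) \sum_(y in K) \tr (B *m rho y *m (A *m rho p) *m rho y^-1%g).
    rewrite [RHS]exchange_big /=; apply: eq_bigr => y _.
    by rewrite !mulmx_sumr mulmx_suml raddf_sum.
  apply: eq_bigr => p Rp; have Kp := subsetP sHK _ (subsetP sRH _ Rp).
  rewrite (reindex_inj (mulIg p^-1%g)) /=.
  apply: eq_big => [y|y Ky]; first by rewrite groupMr ?groupV.
  rewrite invMg invgK !rhoM !mulmxA -(mulmxA _ (rho p^-1%g)) pA ?groupV //.
have st2 (A B : 'M[algC]_#|[set: gT]|) :
    (forall p, p \in R' -> rho p *m B = B) ->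
    #|R'|%:R * \sum_(y in K) \tr (B *m rho y *m A *m rho y^-1%g) =
    \sum_(y in K) \tr (B *m rsum R' *m rho y *m A *m rho y^-1%g).
  move=> pB; rewrite mulr_natl -sumr_const.
  have -> : \sum_(y in K) \tr (B *m rsum R' *m rho y *m A *m rho y^-1%g) =
    \sum_(p in R') \sum_(y in K) \tr (B *m rho p *m rho y *m A *m rho y^-1%g).
    rewrite [RHS]exchange_big /=; apply: eq_bigr => y _.
    by rewrite mulmx_sumr !mulmx_suml raddf_sum.
  apply: eq_bigr => p Rp; have Kp := subsetP sRK' _ Rp.
  rewrite (reindex_inj (mulgI p)) /=.
  apply: eq_big => [y|y Ky]; first by rewrite groupMl.
  rewrite invMg !rhoM !mulmxA mxtrace_mulC !mulmxA pB ?groupV //.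
rewrite mulrAC mulrC st1 ?st2 // => p Rp.
  by rewrite mulmxA rsumMl.
by rewrite mulmxA rsumMl.
Qed.

(* If all the products [s' y s] vanished, then so would [s' b' y b s]; but
   for [y = g^-1] the absorption rules turn the latter into a nonzero multiple
   of [a' b' y a], whose product with [y^-1 a'] is a multiple of [s']. *)
Lemma sym_elt_mul_neq0 g : g \in K ->
    (forall p, p \in R -> (p ^ g)%g \in R') ->
    (forall q, q \in C -> (q ^ g)%g \in C') ->
  exists2 y, y \in K & rsum R' *m csum C' *m rsum R' *m rho y *m
    (rsum R *m csum C *m rsum R) != 0.
Proof.
move=> Kg Rg Cg.
have [sRH sCH _ _] := yp; have [sRK' sCK' _ _] := yp'.
have k0 := lt0r_neq0 (young_kappa_gt0 yp); have k0' := lt0r_neq0 (young_kappa_gt0 yp').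
have := sym_elt_neq0 yp'.
have e2 := young_elt_sqr yp'.
have e3 : csum C *m (rsum R *m csum C *m rsum R) = young_kappa R C *: (csum C *m rsum R).
  have := congr1 (@adj _) (young_elt_sqr yp).
  rewrite adjZ !adjM adj_rsum adj_csum geC0_conj ?(ltW (young_kappa_gt0 yp)) // => <-.
  by rewrite !mulmxA.
have e4 : csum C' *m rho g^-1%g *m csum C = #|C|%:R *: (csum C' *m rho g^-1%g).
  rewrite [_ *m csum C]mulmx_sumr scaler_nat -sumr_const; apply: eq_bigr => q Cq.
  rewrite -scalemxAr -mulmxA -rhoM.
  have -> : (g^-1 * q = q ^ g * g^-1)%g by rewrite conjgE -!mulgA mulgV mulg1.
  rewrite rhoM mulmxA (csumMr (Cg _ Cq)) conjgE !oddM oddV.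
  by rewrite addbC addbK -scalemxAl scalerA -expr2 sqrr_sign scale1r.
have e5 : rho g^-1%g *m rsum R *m rho g *m rsum R' = #|R|%:R *: rsum R'.
  rewrite [rho _ *m rsum R]mulmx_sumr !mulmx_suml scaler_nat -sumr_const.
  apply: eq_bigr => p Rp.
  by rewrite -!rhoM -mulgA -conjgE rsumMl ?Rg.
move=> s0.
case: (pickP (fun y => (y \in K) && (rsum R' *m csum C' *m rsum R' *m rho y *m
    (rsum R *m csum C *m rsum R) != 0))) => [y /andP[Ky ny]|z0]; first by exists y.
case/eqP: s0.
have W0 : rsum R' *m csum C' *m rsum R' *m (csum C' *m rho g^-1%g *m csum C)
   *m (rsum R *m csum C *m rsum R) = 0.
  have -> : csum C' *m rho g^-1%g *m csum C =
    \sum_(q' in C') \sum_(q in C) sg q' * sg q *: rho (q' * g^-1 * q)%g.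
    rewrite /csum !mulmx_suml; apply: eq_bigr => q' _.
    rewrite mulmx_sumr; apply: eq_bigr => q _.
    by rewrite -!scalemxAl -scalemxAr scalerA !rhoM.
  rewrite mulmx_sum2 big1 // => q' Cq'; rewrite big1 // => q Cq.
  rewrite -scalemxAr -scalemxAl.
  have := z0 (q' * g^-1 * q)%g; rewrite !groupM ?groupV //=.
  - by move=> /negbFE/eqP->; rewrite scaler0.
  - exact: (subsetP sCK').
  - exact: (subsetP sHK _ (subsetP sCH _ Cq)).
have W1 : rsum R' *m csum C' *m rho g^-1%g *m rsum R = 0.
  move: W0; have -> : rsum R' *m csum C' *m rsum R' *m (csum C' *m rho g^-1%g *m csum C)
   *m (rsum R *m csum C *m rsum R) = young_elt R' C' *m young_elt R' C' *m rho g^-1%g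
   *m (csum C *m (rsum R *m csum C *m rsum R)) by rewrite /young_elt !mulmxA.
  rewrite e2 e3 -scalemxAr -!scalemxAl.
  have -> : young_elt R' C' *m rho g^-1%g *m (csum C *m rsum R) =
     rsum R' *m (csum C' *m rho g^-1%g *m csum C) *m rsum R by rewrite /young_elt !mulmxA.
  rewrite e4 -scalemxAr -scalemxAl !scalerA => /eqP.
  by rewrite scaler_eq0 !mulf_eq0 (negPf k0) (negPf k0') (negPf (neq0CG C)) /= mulmxA => /eqP.
have : rsum R' *m csum C' *m (rho g^-1%g *m rsum R *m rho g *m rsum R') = 0.
  by rewrite !mulmxA W1 !mul0mx.
rewrite e5 -scalemxAr => /eqP.
by rewrite scaler_eq0 (negPf (neq0CG R)) => /eqP.
Qed.

(** A positive multiple of a sum of squared norms, one of which is nonzero. The element [g] embeds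
    the small pair into the large one. *)
Lemma cfdot_young_char_Res_gt0 g : g \in K ->
    (forall p, p \in R -> (p ^ g)%g \in R') ->
    (forall q, q \in C -> (q ^ g)%g \in C') ->
  0 < '[young_char H R C, 'Res[H] (young_char K R' C')].
Proof.
move=> Kg Rg Cg; have [y Ky Zy] := sym_elt_mul_neq0 Kg Rg Cg.
have k0 := young_kappa_gt0 yp; have k0' := young_kappa_gt0 yp'.
have T0 := natr_card_gt0.
have R0 : 0 < #|R|%:R * #|R'|%:R :> algC by rewrite mulr_gt0 ?ltr0n.
rewrite cfdot_young_char_Res pmulr_rgt0 ?invr_gt0 ?mulr_gt0 //.
rewrite -(pmulr_rgt0 _ R0) sum_tr_young_sym.
have c0 : 0 < (#|R'|%:R * young_kappa R' C') * (#|R|%:R * young_kappa R C).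
  by rewrite !mulr_gt0 ?ltr0n.
rewrite -(pmulr_rgt0 _ c0) mulr_sumr (bigD1 y) //= ltr_wpDr //.
  by rewrite sumr_ge0 // => z _; rewrite tr_sym_elt2 tr_mul_adj_ge0.
by rewrite tr_sym_elt2 tr_mul_adj_gt0.
Qed.

End TwoPairs.

(** A character of norm 1: replacing c y c by its multiple of c reduces the trace formula to
    [sum_ycoef_young_coef]. *)
Lemma young_char_irr (H R C : {group gT}) :
  young_pair H R C -> young_char H R C \in irr H.
Proof.
move=> yp; rewrite irrEchar young_char_char /=; apply/eqP.
rewrite -[X in '[_, X]](cfRes_id (young_char H R C)).
rewrite (cfdot_young_char_Res yp yp) //.
have k0 := lt0r_neq0 (young_kappa_gt0 yp).
have -> : \sum_(y in H) \tr (young_elt R C *m rho y *m young_elt R C *m rho y^-1%g)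
  = #|gT|%:R * \sum_(y in H) ycoef R C y * young_coef R C y.
  rewrite mulr_sumr; apply: eq_bigr => y Hy.
  by rewrite (young_elt_mid yp) // -scalemxAl mxtraceZ tr_young_elt mulrCA [_ * ycoef _ _ _]mulrC.
rewrite (sum_ycoef_young_coef yp) expr2 [#|gT|%:R * _]mulrC mulVf //.
by rewrite !mulf_neq0 ?natr_card_neq0.
Qed.

(** Adjoints turn the vanishing of a y b' into that of b' y a, which sits in the middle of a' b' y a
    b. *)
Lemma young_char_orth (H R C R' C' : {group gT}) :
    young_pair H R C -> young_pair H R' C' ->
    (forall y, y \in H -> rsum R *m rho y *m csum C' = 0) ->
  '[young_char H R C, young_char H R' C'] = 0.
Proof.
move=> yp yp' ab0; rewrite -[X in '[_, X]](cfRes_id (young_char H R' C')).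
rewrite (cfdot_young_char_Res yp yp') // big1 ?mulr0 // => y Hy.
have ba0 : csum C' *m rho y *m rsum R = 0.
  have := congr1 (@adj _) (ab0 y^-1%g (groupVr Hy)).
  rewrite !adjM adj_rsum adj_csum adj_rho invgK mulmxA => ->.
  by apply/matrixP=> i j; rewrite !mxE conjC0.
have -> : young_elt R' C' *m rho y *m young_elt R C *m rho y^-1%g =
   rsum R' *m (csum C' *m rho y *m rsum R) *m csum C *m rho y^-1%g.
  by rewrite /young_elt !mulmxA.
by rewrite ba0 mulmx0 !mul0mx mxtrace0.
Qed.

End YoungPair.
End GroupAlgebra.

(** * Row and column stabilizers *)

Section Tableaux.

Variable N : nat.
Implicit Types (m k J : nat) (lam mu : seq nat) (s t : 'S_N).

Definition below m : {set 'I_N} := [set x : 'I_N | (x < m)%N].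
Local Notation symb m := (perm.Sym_group (below m)).

Lemma in_Sym_below m s : (s \in symb m) = [forall x : 'I_N, (m <= x)%N ==> (s x == x)].
Proof.
rewrite inE; apply/subsetP/forallP => [sm x|sm x].
  by apply/implyP=> mx; apply: contraTT mx => /sm; rewrite inE ltnNge.
by rewrite !inE ltnNge; apply: contra => mx; have := sm x; rewrite mx.
Qed.

Lemma Sym_below_lt m s x : s \in symb m -> (s x < m)%N = (x < m)%N.
Proof. by rewrite inE => /(perm_closed x); rewrite !inE. Qed.

Lemma Sym_belowS m k : (m <= k)%N -> symb m \subset symb k.
Proof.
move=> mk; apply/subsetP=> s; rewrite !in_Sym_below => /forallP sm.
apply/forallP=> x; apply/implyP=> kx; have := sm x.
by rewrite (leq_trans mk kx).
Qed.

Lemma Sym_belowT : symb N = [set: 'S_N] :> {set 'S_N}.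
Proof. by apply/setP=> s; rewrite in_Sym_below inE; apply/forallP=> x; rewrite leqNgt ltn_ord. Qed.

Lemma tperm_Sym_below m (x y : 'I_N) : (x < m)%N -> (y < m)%N -> tperm x y \in symb m.
Proof.
move=> xm ym; rewrite in_Sym_below; apply/forallP=> z; apply/implyP=> mz.
by case: tpermP => // zz; move: mz; rewrite zz leqNgt ?xm ?ym.
Qed.

Lemma stab_group_set (f : 'I_N -> nat) :
  group_set [set s : 'S_N | [forall i, f (s i) == f i]].
Proof.
apply/group_setP; split=> [|s t]; rewrite !inE.
  by apply/forallP=> i; rewrite perm1.
move=> /forallP fs /forallP ft; apply/forallP=> i.
by rewrite permM (eqP (ft _)).
Qed.

Definition stab_group f := Group (stab_group_set f).

(** Past the end of the tableau the reshape functions take values without meaning; [symb m] keeps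
    those points fixed. *)
Definition rowG m lam := (symb m :&: stab_group (fun i => reshape_index lam i))%G.
Definition colG m lam := (symb m :&: stab_group (fun i => reshape_offset lam i))%G.

Lemma rowGP m lam s : reflect (s \in symb m /\
  forall x : 'I_N, (x < m)%N -> reshape_index lam (s x) = reshape_index lam x) (s \in rowG m lam).
Proof.
apply: (iffP setIP) => [[Hs sr]|[Hs sr]]; split=> //.
  by move=> x _; move: sr; rewrite inE => /forallP/(_ x)/eqP.
rewrite inE; apply/forallP=> x; have [/sr->//|mx] := ltnP x m.
by move: Hs; rewrite in_Sym_below => /forallP/(_ x); rewrite mx => /eqP->.
Qed.

Lemma colGP m lam s : reflect (s \in symb m /\
  forall x : 'I_N, (x < m)%N -> reshape_offset lam (s x) = reshape_offset lam x) (s \in colG m lam).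
Proof.
apply: (iffP setIP) => [[Hs sr]|[Hs sr]]; split=> //.
  by move=> x _; move: sr; rewrite inE => /forallP/(_ x)/eqP.
rewrite inE; apply/forallP=> x; have [/sr->//|mx] := ltnP x m.
by move: Hs; rewrite in_Sym_below => /forallP/(_ x); rewrite mx => /eqP->.
Qed.

(** The number of cells in the first [J] columns; comparing it for all [J] is the dominance order on
    conjugate shapes. *)
Definition cut lam J := (\sum_(k < size lam) minn (nth 0 lam k) J)%N.

(** * Cells of the standard filling *)

Section Counting.

Variables (m : nat) (lam : seq nat).
Hypotheses (mN : (m <= N)%N) (lam_m : is_partition m lam).
Local Notation r := (reshape_index lam).
Local Notation c := (reshape_offset lam).

Let sum_lam : sumn lam = m. Proof. by case/and3P: lam_m => _ _ /eqP. Qed.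

Lemma cell_inj (x y : 'I_N) : r x = r y -> c x = c y -> x = y.
Proof.
by move=> rxy cxy; apply: val_inj; rewrite /= -(reshape_indexK lam x) rxy cxy reshape_indexK.
Qed.

Lemma cell_ex k j : (j < nth 0 lam k)%N ->
  exists x : 'I_N, [/\ (x < m)%N, r x = k & c x = j].
Proof.
move=> jk; have xm : (flatten_index lam k j < m)%N by rewrite -sum_lam flatten_indexP.
exists (Ordinal (leq_trans xm mN)).
by rewrite xm /= flatten_indexKl // flatten_indexKr.
Qed.

Lemma cell_lt x : (x < m)%N -> (c x < nth 0 lam (r x))%N.
Proof. by rewrite -sum_lam => /reshape_offsetP. Qed.

Lemma card_row_cut k J :
  #|[set x : 'I_N | [&& x < m, r x == k & c x < J]%N]| = minn (nth 0 lam k) J.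
Proof.
have lt_f (j : 'I_(minn (nth 0 lam k) J)) : (flatten_index lam k j < N)%N.
  apply: leq_trans mN; rewrite -sum_lam; apply: flatten_indexP.
  by have := ltn_ord j; rewrite leq_min => /andP[].
rewrite -[RHS]card_ord -(card_imset predT (f := fun j => Ordinal (lt_f j))); last first.
  by move=> i j [] /addnI ij; apply: val_inj.
apply: eq_card => x; rewrite inE; apply/and3P/imsetP => [[xm /eqP rx cx]|[j _ ->]].
  have cj : (c x < minn (nth 0 lam k) J)%N by rewrite leq_min cx andbT -rx cell_lt.
  by exists (Ordinal cj) => //; apply: val_inj; rewrite /= -rx reshape_indexK.
have := ltn_ord j; rewrite leq_min => /andP[j1 j2] /=.
by rewrite flatten_indexKl // flatten_indexKr // -{1}sum_lam flatten_indexP.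
Qed.

Lemma card_row_split (P : pred 'I_N) :
  #|[set x : 'I_N | (x < m)%N && P x]| =
  (\sum_(k < size lam) #|[set x : 'I_N | [&& (x < m)%N, r x == k & P x]]|)%N.
Proof.
have E (Q : pred 'I_N) : #|[set x | Q x]| = (\sum_x Q x)%N.
  by rewrite -sum1_card big_mkcond; apply: eq_bigr => x _; rewrite inE; case: (Q x).
rewrite E (eq_bigr _ (fun (k : 'I_(size lam)) _ => E _)) exchange_big /=.
apply: eq_bigr => x _; have [xm|_] /= := boolP (x < m)%N; last by rewrite big1.
have rx : (r x < size lam)%N by apply: reshape_indexP; rewrite sum_lam.
rewrite (bigD1 (Ordinal rx)) //= eqxx big1 ?addn0 // => k.
by rewrite -val_eqE /= eq_sym => /negPf->.
Qed.

Lemma card_cut J : #|[set x : 'I_N | (x < m)%N && (c x < J)%N]| = cut lam J.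
Proof. by rewrite card_row_split; apply: eq_bigr => k _; rewrite card_row_cut. Qed.

End Counting.

(** * Permutations that send no two points of a row to one column *)

Section VonNeumann.

Variables (m : nat) (lam mu : seq nat) (s : 'S_N).
Hypotheses (mN : (m <= N)%N) (lam_m : is_partition m lam) (mu_m : is_partition m mu).
Hypothesis Hs : s \in symb m.
Hypothesis no_conflict : forall x y : 'I_N, (x < m)%N -> (y < m)%N ->
  reshape_index lam x = reshape_index lam y ->
  reshape_offset mu (s x) = reshape_offset mu (s y) -> x = y.

(** The points of row [k] go to distinct columns, so at most [J] of them land in the first [J]
    columns. *)
Lemma row_cut_le k J :
  (#|[set x : 'I_N | [&& x < m, reshape_index lam x == k
      & reshape_offset mu (s x) < J]%N]| <= minn (nth 0 lam k) J)%N.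
Proof.
rewrite leq_min; apply/andP; split.
  apply: leq_trans (geq_minl _ (nth 0 lam k)); rewrite -(card_row_cut mN lam_m).
  apply: subset_leq_card; apply/subsetP=> x; rewrite !inE => /and3P[xm /eqP rx _].
  by rewrite xm rx eqxx -rx (cell_lt lam_m).
set A := [set x | _]; rewrite -[J in (_ <= J)%N](size_iota 0) cardE.
rewrite -(size_map (fun x : 'I_N => reshape_offset mu (s x))); apply: uniq_leq_size.
  rewrite map_inj_in_uniq ?enum_uniq // => x y.
  rewrite !mem_enum !inE => /and3P[xm /eqP rx _] /and3P[ym /eqP ry _].
  by apply: no_conflict => //; rewrite rx.
move=> j /mapP[x]; rewrite mem_enum inE => /and3P[_ _ cx] ->.
by rewrite mem_iota.
Qed.

Lemma cut_split J : cut mu J = (\sum_(k < size lam)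
  #|[set x : 'I_N | [&& x < m, reshape_index lam x == k
      & reshape_offset mu (s x) < J]%N]|)%N.
Proof.
rewrite -(card_cut mN mu_m) -(card_row_split lam_m).
rewrite -[LHS](card_preimset _ (@perm_inj _ s)); apply: eq_card => x.
by rewrite !inE Sym_below_lt.
Qed.

Lemma cut_le J : (cut mu J <= cut lam J)%N.
Proof. by rewrite cut_split leq_sum // => k _; apply: row_cut_le. Qed.

End VonNeumann.

(** Each x is sent to a column that exists in its own row. So p can move x, within its row, to the
    column of s x, and p^-1 s then preserves columns. *)
Lemma von_neumann_prod m lam s : (m <= N)%N -> is_partition m lam -> s \in symb m ->
  (forall x y : 'I_N, (x < m)%N -> (y < m)%N ->
    reshape_index lam x = reshape_index lam y ->
    reshape_offset lam (s x) = reshape_offset lam (s y) -> x = y) ->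
  s \in (rowG m lam * colG m lam)%g.
Proof.
move=> mN lam_m Hs nc; have sum_lam : sumn lam = m by case/and3P: lam_m => _ _ /eqP.
have lt_col (x : 'I_N) : (x < m)%N ->
    (reshape_offset lam (s x) < nth 0 lam (reshape_index lam x))%N.
  move=> xm; set k := reshape_index lam x; set J := nth 0%N lam k.
  have kl : (k < size lam)%N by apply: reshape_indexP; rewrite sum_lam.
  (* Source and target shape agree here, so the row bounds add up to equal totals and each of them
     is attained. *)
  have e : #|[set x : 'I_N | [&& x < m, reshape_index lam x == k
      & reshape_offset lam (s x) < J]%N]| = minn (nth 0 lam k) J.
    have := cut_split mN lam_m lam_m Hs J.
    rewrite /cut (bigD1 (Ordinal kl)) // [RHS](bigD1 (Ordinal kl)) //=.
    have /= le1 := row_cut_le mN lam_m nc k J.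
    have le2 : (\sum_(i < size lam | i != Ordinal kl)
      #|[set x : 'I_N | [&& x < m, reshape_index lam x == i
      & reshape_offset lam (s x) < J]%N]| <= 
      \sum_(i < size lam | i != Ordinal kl) minn (nth 0 lam i) J)%N.
      by apply: leq_sum => i _; apply: row_cut_le.
    have aux (a b c d : nat) : (a + b = c + d -> c <= a -> d <= b -> c = a)%N by lia.
    by move=> /aux; apply.
  have e' := card_row_cut mN lam_m k J.
  have sub : [set x : 'I_N | [&& x < m, reshape_index lam x == k
      & reshape_offset lam (s x) < J]%N] \subset
    [set x : 'I_N | [&& x < m, reshape_index lam x == k
      & reshape_offset lam x < J]%N].
    apply/subsetP=> y; rewrite !inE => /and3P[ym /eqP ry _].
    by rewrite ym ry eqxx /J -ry (cell_lt lam_m).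
  have /eqP/setP/(_ x) : [set x : 'I_N | [&& x < m, reshape_index lam x == k
      & reshape_offset lam (s x) < J]%N] ==
    [set x : 'I_N | [&& x < m, reshape_index lam x == k
      & reshape_offset lam x < J]%N].
    by rewrite eqEcard sub e e' leqnn.
  by rewrite !inE xm eqxx /= /J /k (cell_lt lam_m) // => ->.
have pE (x : 'I_N) : exists y : 'I_N, if (x < m)%N then [/\ (y < m)%N,
    reshape_index lam y = reshape_index lam x &
    reshape_offset lam y = reshape_offset lam (s x)] else y = x.
  have [xm|xm] := boolP (x < m)%N; last by exists x.
  exact: (cell_ex mN lam_m (lt_col _ xm)).
have [p /= pP] := fin_all_exists pE.
have p_inj : injective p.
  move=> x y; have := pP x; have := pP y.
  have [ym|ym] := ifP; have [xm|xm] := ifP.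
  - move=> [pym ry cy] [pxm rx cx] pxy; apply: nc => //.
      by rewrite -rx pxy ry.
    by rewrite -cx pxy cy.
  - by move=> [pym _ _] -> pxy; rewrite pxy pym in xm.
  - by move=> -> [pxm _ _] pxy; rewrite -pxy pxm in ym.
  - by move=> -> ->.
have Rp : perm p_inj \in rowG m lam.
  apply/rowGP; split.
    rewrite in_Sym_below; apply/forallP=> x; apply/implyP=> mx; rewrite permE.
    by have := pP x; rewrite ltnNge mx /= => ->.
  by move=> x xm; rewrite permE; have := pP x; rewrite xm => -[].
have Hp : perm p_inj \in symb m by case/rowGP: Rp.
rewrite -(mulKVg (perm p_inj) s) mem_mulg //.
apply/colGP; split; first by rewrite groupM ?groupV.
move=> z zm; rewrite permM -[in RHS](permKV (perm p_inj) z).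
set x := (perm p_inj)^-1%g z; have xm : (x < m)%N by rewrite Sym_below_lt ?groupV.
by rewrite permE; have := pP x; rewrite xm => -[].
Qed.

Lemma conflict_tperm m lam mu s (x y : 'I_N) :
    s \in symb m -> (x < m)%N -> (y < m)%N ->
    reshape_index lam x = reshape_index lam y ->
    reshape_offset mu (s x) = reshape_offset mu (s y) -> x != y ->
  exists t, [/\ t \in rowG m lam, (t ^ s)%g \in colG m mu & odd_perm t].
Proof.
move=> Hs xm ym rxy cxy xy; exists (tperm x y); rewrite odd_tperm xy tpermJ.
split=> //; [apply/rowGP|apply/colGP]; split; rewrite ?tperm_Sym_below ?Sym_below_lt //.
  by move=> z _; case: tpermP => [->|->|].
by move=> z _; case: tpermP => [->|->|].
Qed.

Lemma conflictP m lam mu s :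
  (exists t, [/\ t \in rowG m lam, (t ^ s)%g \in colG m mu & odd_perm t]) \/
   (s \in symb m -> forall x y : 'I_N, (x < m)%N -> (y < m)%N ->
    reshape_index lam x = reshape_index lam y ->
    reshape_offset mu (s x) = reshape_offset mu (s y) -> x = y).
Proof.
have [/existsP[x /existsP[y /and5P[xm ym /eqP rxy /eqP cxy /andP[xy Hs]]]]|nc] :=
  boolP [exists x : 'I_N, exists y : 'I_N,
  [&& x < m, y < m, reshape_index lam x == reshape_index lam y,
  reshape_offset mu (s x) == reshape_offset mu (s y), x != y & s \in symb m]%N].
  by left; apply: conflict_tperm cxy xy.
right=> Hs x y xm ym rxy cxy; apply/eqP; apply: contraNT nc => xy.
by apply/existsP; exists x; apply/existsP; exists y; rewrite xm ym rxy cxy !eqxx xy Hs.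
Qed.

Lemma young_pair_tab m lam : (m <= N)%N -> is_partition m lam ->
  young_pair (@odd_perm _) (symb m) (rowG m lam) (colG m lam).
Proof.
move=> mN lam_m; split; rewrite ?subsetIl //.
  apply/trivgP/subsetP=> s /setIP[/rowGP[Hs rs] /colGP[_ cs]]; apply/set1P/permP=> x.
  rewrite perm1; have [xm|mx] := ltnP x m.
    by apply: (@cell_inj lam); rewrite ?rs ?cs.
  by move: Hs; rewrite in_Sym_below => /forallP/(_ x); rewrite mx => /eqP.
move=> s Hs; have [|nc] := conflictP m lam lam s; first by right.
by left; apply: von_neumann_prod => //; apply: nc.
Qed.

(** Without two points of one row going to one column, [cut_le] would contradict the hypothesis;
    their transposition kills the product. *)
Lemma cut_lt_rsum0 m lam mu J s : (m <= N)%N -> is_partition m lam -> is_partition m mu ->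
  s \in symb m -> (cut lam J < cut mu J)%N ->
  rsum (rowG m lam) *m rho s *m csum (@odd_perm _) (colG m mu) = 0.
Proof.
move=> mN lam_m mu_m Hs lt_cut; have [[t [Rt Ct ot]]|nc] := conflictP m lam mu s.
  by apply: rsum_rho_csum0 Rt Ct ot => x y; apply: odd_permM.
by have := cut_le mN lam_m mu_m Hs (nc Hs) J; rewrite leqNgt lt_cut.
Qed.


End Tableaux.

(** * Adding and removing boxes *)

Section Partitions.

Implicit Types (m i j k : nat) (lam mu : seq nat).

Lemma is_partitionP m lam : reflect
  [/\ forall i, (nth 0 lam i.+1 <= nth 0 lam i)%N,
      forall i, (i < size lam)%N -> (0 < nth 0 lam i)%N & sumn lam = m]
  (is_partition m lam).
Proof.
apply: (iffP and3P) => [[/(sortedP 0%N) s l0 /eqP e]|[s l0 e]]; split=> //.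
- move=> i; have [/s//|le] := ltnP i.+1 (size lam).
  by rewrite (nth_default _ le).
- by move=> i il; rewrite lt0n; apply: contra l0 => /eqP <-; apply: mem_nth.
- by apply/(sortedP 0%N) => i _; apply: s.
- by apply/negP => /(nthP 0%N)[i /l0 + e0]; rewrite e0.
- exact/eqP.
Qed.

Lemma partition_size m lam i : is_partition m lam ->
  (i < size lam)%N = (0 < nth 0%N lam i)%N.
Proof.
move=> /is_partitionP[_ l0 _]; apply/idP/idP => [/l0//|]; apply: contraLR.
by rewrite -leqNgt => /(nth_default 0%N)->.
Qed.

Lemma partition_eq m m' lam mu : is_partition m lam -> is_partition m' mu ->
  (forall i, nth 0%N lam i = nth 0%N mu i) -> lam = mu.
Proof.
move=> pl pm e; apply: (@eq_from_nth _ 0%N) => // ; apply/eqP; rewrite eqn_leq.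
apply/andP; split; rewrite leqNgt.
  by rewrite (partition_size _ pl) e -(partition_size _ pm) ltnn.
by rewrite (partition_size _ pm) -e -(partition_size _ pl) ltnn.
Qed.

Lemma partition_size_le m lam : is_partition m lam -> (size lam <= m)%N.
Proof.
case/and3P=> _ l0 /eqP <-; elim: lam l0 => //= x l IH.
by rewrite inE negb_or eq_sym -lt0n => /andP[x0 /IH]; lia.
Qed.

Lemma nth_sumn_le (s : seq nat) i : (nth 0 s i <= sumn s)%N.
Proof.
elim: s i => [|x s IH] [|i] //=; first by rewrite leq_addr.
by rewrite (leq_trans (IH i)) // leq_addl.
Qed.

Definition removable lam i := (nth 0 lam i.+1 < nth 0 lam i)%N.
(** The default 0 of [nth] lets [i = size mu] start a new row and excludes all later rows. *)
Definition addable mu i := (i == 0)%N || (nth 0 mu i < nth 0 mu i.-1)%N.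
(** A removable row of length one is the last row; it is cut off, since a zero left in the list
    would not be a part. *)
Definition rem_box i lam :=
  if nth 0%N lam i == 1%N then take i lam else set_nth 0%N lam i (nth 0%N lam i).-1.
Definition add_box i mu := set_nth 0%N mu i (nth 0%N mu i).+1.

Lemma nth_rem_box m lam i k : is_partition m lam -> removable lam i ->
  nth 0%N (rem_box i lam) k = if k == i then (nth 0%N lam i).-1 else nth 0%N lam k.
Proof.
move=> pl rl; rewrite /rem_box; case: eqP => [e|_]; last by rewrite nth_set_nth.
have sl : size lam = i.+1.
  apply/eqP; rewrite eqn_leq (partition_size i pl) e andbT leqNgt (partition_size _ pl).
  by move: rl; rewrite /removable e; case: (nth _ _ _).
have [ki|ki|ki] := ltngtP k i.
- by rewrite nth_take.
- by rewrite !nth_default // ?size_take ?sl ?ltnS ?leqnn //; lia.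
- by rewrite ki e nth_default // size_take sl ltnSn.
Qed.

Lemma rem_box_partition m lam i : is_partition m.+1 lam -> removable lam i ->
  is_partition m (rem_box i lam).
Proof.
move=> pl rl; have nE := nth_rem_box _ pl rl; have [s l0 e] := is_partitionP _ _ pl.
have il : (i < size lam)%N by rewrite (partition_size _ pl); move: rl; rewrite /removable; lia.
apply/is_partitionP; split.
- move=> j; rewrite !nE; have := s j; move: rl; rewrite /removable.
  by case: eqP => [->|_]; case: eqP => [->|_]; lia.
- move=> j; rewrite /rem_box; case: eqP => [ei|ei].
    by rewrite size_take il => ji; rewrite nth_take // l0 // (ltn_trans ji).
  rewrite size_set_nth (maxn_idPr il) nth_set_nth /= => jl.
  by have := l0 _ jl; have := l0 _ il; case: eqP => [->|] //; lia.
- rewrite /rem_box; case: eqP => [ei|ei]; last first.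
    by rewrite sumn_set_nth0 e; have := l0 _ il; lia.
  have sl : size lam = i.+1.
    apply/eqP; rewrite eqn_leq il andbT leqNgt (partition_size _ pl).
    by move: rl; rewrite /removable ei; case: (nth _ _ _).
  have := congr1 sumn (cat_take_drop i lam); rewrite sumn_cat e.
  by rewrite (drop_nth 0%N il) -sl drop_size /= ei; lia.
Qed.

Lemma nth_add_box mu i k :
  nth 0%N (add_box i mu) k = if k == i then (nth 0%N mu i).+1 else nth 0%N mu k.
Proof. by rewrite nth_set_nth. Qed.

Lemma add_box_partition m mu i : is_partition m mu -> addable mu i ->
  is_partition m.+1 (add_box i mu).
Proof.
move=> pm; have [s l0 e] := is_partitionP _ _ pm => am.
have im : (i <= size mu)%N.
  case: i am => // i; rewrite /addable /= => am; rewrite (partition_size _ pm); lia.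
apply/is_partitionP; split.
- move=> j; rewrite !nth_add_box; have := s j; have [ji|_] := eqVneq j.+1 i.
    by move: am; rewrite -ji /addable /= (ltn_eqF (ltnSn j)).
  by have [->|_] := eqVneq j i; lia.
- move=> j; rewrite size_set_nth nth_add_box; case: eqP => // ji.
  by rewrite leq_max => jm; apply: l0; lia.
- by rewrite sumn_set_nth0 e; lia.
Qed.

Lemma add_rem_box m lam mu i : is_partition m.+1 lam -> is_partition m mu ->
  (addable mu i && (add_box i mu == lam)) = (removable lam i && (rem_box i lam == mu)).
Proof.
move=> pl pm; have [s _ _] := is_partitionP _ _ pm; apply/andP/andP.
  move=> [am /eqP e].
  have rl : removable lam i.
    rewrite /removable -e !nth_add_box eqxx; have := s i; case: eqP; lia.
  split=> //; apply/eqP; apply: (partition_eq (rem_box_partition pl rl) pm) => k.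
  rewrite (nth_rem_box _ pl rl) -e !nth_add_box eqxx /=.
  by case: eqP => // ->.
move=> [rl /eqP e]; have nE := nth_rem_box _ pl rl.
have [s' _ _] := is_partitionP _ _ pl.
have am : addable mu i.
  rewrite /addable; case: i rl e nE => // i rl <- nE /=; rewrite !nE eqxx.
  by have := s' i; move: rl; rewrite /removable; case: eqP; lia.
split=> //; apply/eqP; apply: (partition_eq (add_box_partition pm am) pl) => k.
rewrite nth_add_box -e !nE eqxx; case: eqP => // ->.
by move: rl; rewrite /removable; lia.
Qed.

Lemma count_cut lam J : (cut lam J.+1 - cut lam J)%N = count (fun x => J < x)%N lam.
Proof.
have -> : cut lam J.+1 = (cut lam J + \sum_(k < size lam) (J < nth 0 lam k))%N.
  by rewrite /cut -big_split /=; apply: eq_bigr => k _; case: ltnP; lia.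
rewrite addKn -sum1_count -(big_mkord predT (fun k => nat_of_bool (J < nth 0 lam k)%N)).
by rewrite -(big_nth 0%N predT (fun x => nat_of_bool (J < x)%N)) [RHS]big_mkcond.
Qed.

(** Differences of consecutive cuts count the parts larger than [J], hence determine all
    multiplicities. *)
Lemma cut_inj m lam mu : is_partition m lam -> is_partition m mu ->
  (forall J, cut lam J = cut mu J) -> lam = mu.
Proof.
move=> /and3P[sl l0 _] /and3P[sm m0 _] e.
apply: (@sorted_eq _ geq) => //.
- by move=> x y z /= xy yz; apply: leq_trans yz xy.
- by move=> x y /= /anti_leq.
apply/allP=> x _ /=; apply/eqP.
have cE J : count (fun x => J < x)%N lam = count (fun x => J < x)%N mu.
  by rewrite -!count_cut !e.
case: x => [|x]; first by rewrite !(count_memPn _).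
have c1 (l : seq nat) : count (fun y => x < y)%N l = (count_mem x.+1 l + count (fun y => x.+1 < y)%N l)%N.
  rewrite -count_predUI -[LHS]addn0; congr (_ + _)%N.
    by apply: eq_count => y /=; rewrite leq_eqVlt eq_sym.
  symmetry; apply/eqP; rewrite -leqn0 leqNgt -has_count; apply/hasPn=> y _ /=.
  by case: eqP => // ->; rewrite ltnn.
by have := cE x; rewrite !c1 cE => /addIn.
Qed.

End Partitions.

(** * The branching rule *)

Section Branching.

Variable N : nat.
Implicit Types (m k : nat) (lam mu : seq nat) (s : 'S_N).
Local Notation symb m := (perm.Sym_group (below N m)).

Definition specht_char m lam : 'CF(symb m) :=
  young_char (@odd_perm _) (symb m) (rowG N m lam) (colG N m lam).

Let oddM := @odd_permM 'I_N.

Lemma specht_char_irr m lam : (m <= N)%N -> is_partition m lam ->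
  specht_char m lam \in irr (symb m).
Proof. by move=> mN pl; apply: young_char_irr => //; apply: young_pair_tab. Qed.

Lemma specht_char_char m lam : specht_char m lam \is a character.
Proof. exact: young_char_char. Qed.

(** Distinct shapes differ in some cut. A strict inequality at this one [J], in either direction,
    already gives orthogonality, by symmetry of the product. *)
Lemma cfdot_specht_char m lam mu : (m <= N)%N -> is_partition m lam -> is_partition m mu ->
  '[specht_char m lam, specht_char m mu] = (lam == mu)%:R.
Proof.
move=> mN pl pm; have [->|ne] := eqVneq lam mu.
  by have := specht_char_irr mN pm; rewrite irrEchar => /andP[_ /eqP].
have [yl ym] := (young_pair_tab mN pl, young_pair_tab mN pm).
suff orth lam' mu' J : is_partition m lam' -> is_partition m mu' ->
    (cut lam' J < cut mu' J)%N -> '[specht_char m lam', specht_char m mu'] = 0.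
  (* Cuts are constant from [J = m] on, so the search for [J] is finite. *)
  have /existsP[J neJ] : [exists J : 'I_(m.+1), cut lam J != cut mu J].
    apply: contraNT ne => /existsPn eJ; apply/eqP; apply: (cut_inj pl pm) => J.
    have cutm l : is_partition m l -> forall J, (m <= J)%N -> cut l J = cut l m.
      move=> pl' J' mJ; apply: eq_bigr => k _.
      have le : (nth 0%N l k <= m)%N by case/and3P: pl' => _ _ /eqP <-; apply: nth_sumn_le.
      by rewrite (minn_idPl le) (minn_idPl (leq_trans le mJ)).
    have [Jm|mJ] := ltnP J m.+1; first by have := eJ (Ordinal Jm); rewrite negbK => /eqP.
    by rewrite !(cutm _ _ J) // ?(ltnW mJ) //; have := eJ ord_max; rewrite negbK => /eqP.
  move: neJ; rewrite neq_ltn => /orP[] ltJ; first exact: orth ltJ.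
  by rewrite cfdotC (orth _ _ _ pm pl ltJ) conjC0.
move=> pl' pm' ltJ; apply: young_char_orth => //; [exact: young_pair_tab|exact: young_pair_tab|].
by move=> y Hy; apply: cut_lt_rsum0 ltJ.
Qed.

(** Both tableaux are numbered row by row, so adding a box shifts the later numbers. The renumbering
    [g] places the old tableau in the new one and sends the point m to the added cell. *)
Lemma add_box_perm m mu i : (m < N)%N -> is_partition m mu -> addable mu i ->
  exists2 g : 'S_N, g \in symb m.+1 & forall x : 'I_N, (x < m)%N ->
    reshape_index (add_box i mu) (g x) = reshape_index mu x /\
    reshape_offset (add_box i mu) (g x) = reshape_offset mu x.
Proof.
move=> mN pm am; have pl := add_box_partition pm am; set lam := add_box i mu in pl *.
pose r x := if (x < m)%N then reshape_index mu x else i.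
pose c x := if (x < m)%N then reshape_offset mu x else nth 0%N mu i.
have gE (x : 'I_N) : exists y : 'I_N, if (x < m.+1)%N then [/\ (y < m.+1)%N,
    reshape_index lam y = r x & reshape_offset lam y = c x] else y = x.
  have [xm|xm] := boolP (x < m.+1)%N; last by exists x.
  apply: (cell_ex mN pl); rewrite nth_add_box /r /c; case: ifP => [xm'|_].
    by have := cell_lt pm xm'; case: eqP => // ->; lia.
  by rewrite eqxx.
have [g /= gP] := fin_all_exists gE.
have g_inj : injective g.
  move=> x y; have := gP x; have := gP y.
  have [ym|ym] := ifP; have [xm|xm] := ifP.
  - move=> [_ ry cy] [_ rx cx] gxy; move: rx cx; rewrite gxy ry cy /r /c => {ry cy}.
    have [xm'|xm'] := ltnP x m; have [ym'|ym'] := ltnP y m.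
    + by move=> rr cc; apply: (@cell_inj _ mu).
    + by move=> ri ci; have := cell_lt pm xm'; rewrite -ri -ci ltnn.
    + by move=> ri ci; have := cell_lt pm ym'; rewrite ri ci ltnn.
    + by move=> _ _; apply: val_inj => /=; lia.
  - by move=> [gym _ _] -> gxy; rewrite gxy gym in xm.
  - by move=> -> [gxm _ _] gxy; rewrite -gxy gxm in ym.
  - by move=> -> ->.
exists (perm g_inj).
  rewrite in_Sym_below; apply/forallP=> x; apply/implyP=> mx; rewrite permE.
  by have := gP x; rewrite ltnNge mx /= => ->.
move=> x xm; rewrite permE; have := gP x; rewrite (ltn_trans xm) // => -[_ -> ->].
by rewrite /r /c xm.
Qed.

Lemma symb_conj_stab m (f f' : nat -> nat) g s (x : 'I_N) : (m < N)%N ->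
    g \in symb m.+1 -> (forall x : 'I_N, (x < m)%N -> f' (g x) = f x) ->
    s \in symb m -> (forall x : 'I_N, (x < m)%N -> f (s x) = f x) ->
  f' ((s ^ g)%g x) = f' x.
Proof.
move=> mN Hg fg Hs fs; rewrite conjgE !permM -[in RHS](permKV g x).
set z := g^-1%g x; have [zm|mz] := ltnP z m.
  by rewrite (fg z) // fg; [apply: fs|rewrite Sym_below_lt].
by move: Hs; rewrite in_Sym_below => /forallP/(_ z); rewrite mz => /eqP->.
Qed.

Lemma specht_char_add m mu i : (m < N)%N -> is_partition m mu -> addable mu i ->
  1 <= '[specht_char m mu, 'Res[symb m] (specht_char m.+1 (add_box i mu))].
Proof.
move=> mN pm am; have pl := add_box_partition pm am.
have [g Hg gP] := add_box_perm mN pm am.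
have Hsub : symb m \subset symb m.+1 by apply: Sym_belowS.
have conjH s : s \in symb m -> (s ^ g)%g \in symb m.+1.
  by move=> Hs; rewrite groupJ // (subsetP Hsub).
have : 0 < '[specht_char m mu, 'Res[symb m] (specht_char m.+1 (add_box i mu))].
  apply: (@cfdot_young_char_Res_gt0 _ _ oddM _ _ _ _ _ _ _ _ _ g) => //.
  - by apply: young_pair_tab => //; apply: ltnW.
  - exact: young_pair_tab.
  - move=> p /rowGP[Hp rp]; apply/rowGP; split; first exact: conjH.
    by move=> x _; apply: (symb_conj_stab x mN Hg _ Hp rp) => z /gP[].
  - move=> p /colGP[Hp rp]; apply/colGP; split; first exact: conjH.
    by move=> x _; apply: (symb_conj_stab x mN Hg _ Hp rp) => z /gP[].
have /natrP[n ->] := Cnat_cfdot_char (specht_char_char m mu)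
  (cfRes_char (symb m) (specht_char_char m.+1 (add_box i mu))).
by rewrite ltr0n ler1n.
Qed.

Definition fixc m s := #|[set x : 'I_N | (x < m)%N && (s x == x)]|.

Lemma fixc_conj m s g : g \in symb m -> fixc m (s ^ g)%g = fixc m s.
Proof.
move=> Hg; rewrite /fixc -(card_preimset _ (@perm_inj _ g)); apply: eq_card => x.
by rewrite !inE Sym_below_lt // conjgE !permM permK (inj_eq perm_inj).
Qed.

(** * Inducing from S_m to S_(m+1) *)

Section Induction.

Variable m : nat.
Hypothesis mN : (m < N)%N.
Let top := Ordinal mN.

Lemma symb_top s : s \in symb m.+1 -> (s \in symb m) = (s top == top).
Proof.
move=> Hs; apply/idP/idP => [|st].
  by rewrite in_Sym_below => /forallP/(_ top); rewrite leqnn.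
rewrite in_Sym_below; apply/forallP=> x; apply/implyP; rewrite leq_eqVlt.
case/orP=> [/eqP mx|mx]; first by have -> : x = top by apply: val_inj.
by move: Hs; rewrite in_Sym_below => /forallP/(_ x); rewrite mx.
Qed.

Lemma fixcS s : s \in symb m -> fixc m.+1 s = (fixc m s).+1.
Proof.
move=> Hs; rewrite /fixc (cardsD1 top) inE ltnSn /=.
have -> : s top == top by rewrite -symb_top // (subsetP (Sym_belowS _ (leqnSn m))).
rewrite add1n; congr _.+1; apply: eq_card => x; rewrite !inE ltnS -val_eqE /=.
by rewrite andbA ltn_neqAle.
Qed.

Lemma card_symb_fiber (x : 'I_N) : (x < m.+1)%N ->
  #|[set y in symb m.+1 | (y^-1)%g top == x]| = #|symb m|.
Proof.
move=> xm; have Ht : tperm x top \in symb m.+1 by apply: tperm_Sym_below => /=.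
rewrite -[RHS](card_imset _ (mulgI (tperm x top))); apply: eq_card => y.
apply/setIdP/imsetP => [[Hy /eqP yx]|[z Hz ->]].
  exists (tperm x top * y)%g; last by rewrite mulgA tperm2 mul1g.
  by rewrite symb_top ?groupM // permM tpermR -yx permKV.
have Hz' : z \in symb m.+1 by apply: (subsetP (Sym_belowS _ (leqnSn m))).
split; first by rewrite groupM.
rewrite invMg permM tpermV.
have -> : (z^-1)%g top = top by apply/eqP; rewrite -symb_top ?groupV.
by rewrite tpermR.
Qed.

(** The conjugate [g ^ y] lies in S_m exactly when y^-1 takes the point m to a fixed point of [g],
    and each point arises in this way from |S_m| elements y. *)
Lemma cfInd_symb (phi : 'CF(symb m)) g v : g \in symb m.+1 ->
    (forall y, y \in symb m.+1 -> (g ^ y)%g \in symb m -> phi (g ^ y)%g = v) ->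
  'Ind[symb m.+1] phi g = (fixc m.+1 g)%:R * v.
Proof.
move=> Hg phiv; rewrite cfIndE ?Sym_belowS //.
have -> : \sum_(y in symb m.+1) phi (g ^ y)%g =
  \sum_(y in symb m.+1) \sum_(x : 'I_N | (x < m.+1)%N && (g x == x))
     ((y^-1)%g top == x)%:R * v.
  apply: eq_bigr => y Hy; set z := (y^-1)%g top.
  have zm : (z < m.+1)%N by rewrite Sym_below_lt ?groupV /=.
  have gy : ((g ^ y)%g \in symb m) = (g z == z).
    rewrite symb_top ?groupJ // conjgE !permM -/z.
    by rewrite -[in X in _ = X](inj_eq (@perm_inj _ y)) permKV.
  have [gz|gz] := boolP (g z == z).
    rewrite phiv ?gy // (bigD1 z) ?zm //= eqxx mul1r big1 ?addr0 // => x /andP[_ xz].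
    by rewrite eq_sym (negPf xz) mul0r.
  rewrite cfun0 ?gy //; symmetry; apply: big1 => x /andP[_ gx].
  by case: eqP => [zx|]; rewrite ?mul0r //; rewrite zx gx in gz.
rewrite exchange_big /= (eq_bigr (fun=> #|symb m|%:R * v)) => [|x /andP[xm _]].
  rewrite sumr_const -[X in _ * X]mulr_natl [X in _ * X]mulrCA mulKf ?neq0CG //.
  congr (_%:R * _).
  by rewrite /fixc -cardsE; apply: eq_card => x; rewrite !inE.
rewrite -mulr_suml; congr (_ * _); rewrite -(card_symb_fiber xm) -sum1_card natr_sum.
rewrite big_mkcond [RHS]big_mkcond /=; apply: eq_bigr => y _.
have -> : (y \in [set y in symb m.+1 | (y^-1)%g top == x]) = (y \in symb m.+1) && ((y^-1)%g top == x).
  by apply/setIdP/andP.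
by case: (y \in symb m.+1); case: (_ == _).
Qed.

(** Elements of S_m conjugate under S_(m+1) are already conjugate under S_m, so [phi] is constant on
    the relevant conjugates; the point m is the one extra fixed point. *)
Lemma cfRes_Ind_symb (phi : 'CF(symb m)) g : g \in symb m ->
  'Ind[symb m.+1] phi g = phi g * (fixc m g).+1%:R.
Proof.
move=> Hg; have Hg' : g \in symb m.+1 by apply: (subsetP (Sym_belowS _ (leqnSn m))).
rewrite (cfInd_symb Hg' (v := phi g)) ?fixcS 1?mulrC // => y Hy.
rewrite (symb_top (groupJ Hg' Hy)) {1}conjgE !permM.
rewrite -[X in _ == X](permKV y) (inj_eq perm_inj); set i := (y^-1)%g top => /eqP gi.
have im : (i < m.+1)%N by rewrite Sym_below_lt ?groupV /=.
have Ht : tperm i top \in symb m.+1 by apply: tperm_Sym_below.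
have gtop : g top = top by apply/eqP; rewrite -symb_top.
(* As [g] fixes both points, the transposition commutes with it; multiplying y by it gives a
   conjugating element that fixes [top]. *)
have gt : (g ^ tperm i top = g)%g.
  have tg : (tperm i top ^ g = tperm i top)%g by rewrite tpermJ gi gtop.
  by rewrite conjgE -{2}tg -conjgC mulKg.
rewrite -{1}gt -conjgM cfunJ // symb_top ?groupM //.
by rewrite permM tpermR /i permKV.
Qed.

End Induction.

(** This is the permutation character on ordered (m - k)-tuples of distinct points, built up one
    point at a time. *)
Lemma cfInd_cfun1_symb k m g : (k <= m)%N -> (m <= N)%N -> g \in symb m ->
  'Ind[symb m, symb k] 1 g = ((fixc m g) ^_ (m - k))%:R.
Proof.
move=> km; rewrite -(subnKC km); elim: (m - k)%N g => [|d IH] g.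
  by rewrite addn0 subnn => _ Hg; rewrite cfInd_id cfun1E Hg ffactn0.
rewrite addnS => dN Hg; rewrite -(@cfIndInd _ _ (symb (k + d))) ?Sym_belowS ?leq_addr //.
rewrite (cfInd_symb dN Hg (v := ((fixc (k + d).+1 g).-1 ^_ d)%:R)).
  by rewrite subSn ?leq_addr // addKn -natrM -ffactnS.
move=> y Hy Hgy; rewrite IH ?addKn ?(ltnW dN) //.
by rewrite -(fixc_conj g Hy) fixcS.
Qed.

(** The identity Res (Ind phi) = phi + Ind (Res phi) is checked pointwise: Ind (Res phi) = phi Ind
    1, and Ind 1 counts fixed points. *)
Lemma cfnorm_Ind_symb m (phi : 'CF(symb m.+1)) : (m.+1 < N)%N ->
  '['Ind[symb m.+2] phi] = '[phi] + '['Res[symb m] phi].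
Proof.
move=> mN; have mm : symb m \subset symb m.+1 by apply: Sym_belowS.
have E : 'Res[symb m.+1] ('Ind[symb m.+2] phi) = phi + 'Ind[symb m.+1] ('Res[symb m] phi).
  apply/cfun_inP=> g Hg; rewrite cfResE ?Sym_belowS // cfRes_Ind_symb // cfunE.
  rewrite -['Res[symb m] phi]mul1r cfIndM // cfunE cfInd_cfun1_symb //; last exact: ltnW.
  by rewrite subSnn ffactn1 mulrSr mulrDr mulr1 addrC mulrC.
rewrite -Frobenius_reciprocity E cfdotDr; congr (_ + _).
by rewrite cfdotC -Frobenius_reciprocity geC0_conj ?cfnorm_ge0.
Qed.

Lemma cfnorm_Ind_symb0 (phi : 'CF(symb 0)) : (0 < N)%N ->
  '['Ind[symb 1] phi] = '[phi].
Proof.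
move=> N0; rewrite -Frobenius_reciprocity; congr '[_, _].
apply/cfun_inP=> g Hg; rewrite cfResE ?Sym_belowS // cfRes_Ind_symb //.
rewrite /fixc (_ : #|_| = 0%N) ?mulr1 //; apply/eqP.
by rewrite cards_eq0; apply/eqP/setP=> x; rewrite !inE.
Qed.

Definition irr_complete m := forall chi, chi \in irr (symb m) ->
  exists2 lam, is_partition m lam & chi = specht_char m lam.

(** Row i + 1 accepts a box exactly when row i can lose one; row 0 always accepts one. *)
Lemma sum_addable m mu :
  (\sum_(i < m.+1) addable mu i = (\sum_(i < m) removable mu i).+1)%N.
Proof. by rewrite big_ord_recl /= add1n; congr _.+1; apply: eq_bigr => i _. Qed.

Lemma cfnorm_sum_specht_char m n (f : nat -> seq nat) (P : pred nat) : (m <= N)%N ->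
    (forall i, P i -> is_partition m (f i)) ->
    (forall i j, P i -> P j -> f i = f j -> i = j) ->
  '[\sum_(i < n | P i) specht_char m (f i)] = (\sum_(i < n) P i)%N%:R.
Proof.
move=> mN fp finj; rewrite cfdot_suml natr_sum big_mkcond; apply: eq_bigr => i _ /=.
case: ifP => [Pi|//]; rewrite cfdot_sumr (bigD1 i) //= cfdot_specht_char ?fp // eqxx.
rewrite big1 ?addr0 // => j /andP[Pj ji]; rewrite cfdot_specht_char ?fp //.
by case: eqP => // /finj e; case/eqP: ji; apply: val_inj; rewrite /= -e.
Qed.

Lemma add_box_inj m mu i j : is_partition m mu -> add_box i mu = add_box j mu -> i = j.
Proof.
move=> pm e; have := congr1 (nth 0%N ^~ i) e; rewrite !nth_add_box eqxx.
by case: eqP => // _; lia.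
Qed.

(** The induced character I and the expected sum S have the same norm, and the product of I with S
    is at least that norm; so I - S has norm at most 0. *)
Lemma specht_char_Ind m mu : (m < N)%N -> is_partition m mu ->
  '['Ind[symb m.+1] (specht_char m mu)] = (\sum_(i < m.+1) addable mu i)%N%:R ->
  'Ind[symb m.+1] (specht_char m mu) =
    \sum_(i < m.+1 | addable mu i) specht_char m.+1 (add_box i mu).
Proof.
move=> mN pm nI; set S := \sum_(i < _ | _) _; set I := 'Ind[_] _ in nI *.
have nS : '[S] = (\sum_(i < m.+1) addable mu i)%N%:R.
  apply: (@cfnorm_sum_specht_char _ _ (fun i => add_box i mu)) => // [i ai|i j _ _].
    exact: add_box_partition.
  exact: add_box_inj pm.
have IS : '[S] <= '[I, S].
  rewrite nS cfdot_sumr natr_sum big_mkcond [X in _ <= X]big_mkcond /=.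
  apply: ler_sum => i _; case: ifP => [ai|//].
  by rewrite -Frobenius_reciprocity specht_char_add.
have IS_real : '[I, S]^* = '[I, S].
  by rewrite geC0_conj // (le_trans _ IS) // cfnorm_ge0.
apply/eqP; rewrite -subr_eq0 -cfnorm_eq0 eq_le cfnorm_ge0 andbT.
by rewrite cfnormB IS_real nI -nS subr_le0 lerD.
Qed.

(** By completeness it is enough to pair the difference with Specht characters, where Frobenius
    reciprocity turns removed boxes into added ones. *)
Lemma specht_char_Res m lam : (m < N)%N -> is_partition m.+1 lam -> irr_complete m ->
    (forall mu, is_partition m mu -> 'Ind[symb m.+1] (specht_char m mu) =
      \sum_(i < m.+1 | addable mu i) specht_char m.+1 (add_box i mu)) ->
  'Res[symb m] (specht_char m.+1 lam) =
    \sum_(i < m.+1 | removable lam i) specht_char m (rem_box i lam).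
Proof.
move=> mN pl compl ind; apply/eqP; rewrite -subr_eq0; set D := _ - _.
rewrite [D]cfun_sum_cfdot big1 // => i _; have [mu pm ->] := compl _ (mem_irr i).
rewrite cfdotBl cfdotC Frobenius_reciprocity ind //.
rewrite !cfdot_suml (_ : _^* = \sum_(i < m.+1 | addable mu i) (add_box i mu == lam)%:R).
  rewrite [X in _ - X](eq_bigr (fun i : 'I_m.+1 => (rem_box i lam == mu)%:R)) => [|j rj]; last first.
    by rewrite cfdot_specht_char ?(ltnW mN) // (rem_box_partition pl rj).
  rewrite big_mkcond [X in _ - X]big_mkcond /= (eq_bigr (fun i : 'I_m.+1 =>
    if removable lam i then (rem_box i lam == mu)%:R else 0)) ?subrr ?scale0r // => j _.
  have := add_rem_box j pl pm.
  by case: (addable _ _); case: (removable _ _) => //= e;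
    first [by rewrite e | by rewrite -e].
rewrite rmorph_sum; apply: eq_bigr => j aj.
by rewrite cfdot_specht_char ?rmorph_nat // (add_box_partition pm aj).
Qed.

Lemma branching m : (m < N)%N ->
  [/\ irr_complete m,
    forall mu, is_partition m mu -> 'Ind[symb m.+1] (specht_char m mu) =
      \sum_(i < m.+1 | addable mu i) specht_char m.+1 (add_box i mu)
  & forall lam, is_partition m.+1 lam -> 'Res[symb m] (specht_char m.+1 lam) =
      \sum_(i < m.+1 | removable lam i) specht_char m (rem_box i lam)].
Proof.
elim: m => [|m IH] mN.
  have p0 : is_partition 0 [::] by [].
  have compl : irr_complete 0.
    move=> chi ichi; exists [::] => //.
    have /irrP[i ei] := ichi; have /irrP[j ej] := specht_char_irr (leq0n N) p0.
    have sym1 (x : 'S_N) : x \in symb 0 -> x = 1%g.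
      rewrite in_Sym_below => /forallP x0; apply/permP=> y; rewrite perm1.
      exact/eqP/(implyP (x0 y)).
    rewrite ei ej; congr ('chi_ _); apply/eqP; rewrite -[_ == _]negbK; apply/negP=> ij.
    have /eqP := cfdot_irr i j; rewrite (negPf ij) cfdotE (bigD1 1%g) ?group1 //= big1.
      by rewrite addr0 !mulf_eq0 conjC_eq0 !(negPf (irr1_neq0 _)) invr_eq0 (negPf (neq0CG _)).
    by move=> x /andP[/sym1 ->]; rewrite eqxx.
  have ind mu : is_partition 0 mu -> 'Ind[symb 1] (specht_char 0 mu) =
      \sum_(i < 1 | addable mu i) specht_char 1 (add_box i mu).
    move=> pm; apply: specht_char_Ind => //.
    by rewrite cfnorm_Ind_symb0 // cfdot_specht_char // eqxx big_ord_recl big_ord0.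
  by split=> // lam pl; apply: specht_char_Res.
have [compl ind res] := IH (ltnW mN).
(* An irreducible character has a Specht character in its restriction, so it occurs in the induced
   one, which is a sum of Specht characters. *)
have compl' : irr_complete m.+1.
  move=> chi ichi; have /irrP[i ei] := ichi.
  have [j] := constt_cfRes_irr (symb m) i; rewrite irr_consttE.
  have [mu pm ->] := compl _ (mem_irr j); rewrite cfdotC conjC_eq0 Frobenius_reciprocity ind //.
  rewrite cfdot_suml => nz.
  have [k ak /eqP] : exists2 k : 'I_m.+1, addable mu k &
      '[specht_char m.+1 (add_box k mu), 'chi_i] != 0.
    case: (pickP (fun k : 'I_m.+1 => addable mu k &&
      ('[specht_char m.+1 (add_box k mu), 'chi_i] != 0))) => [k /andP[]|z]; first by exists k.
    by case/eqP: nz; apply: big1 => k ak; have := z k; rewrite ak => /negbFE/eqP.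
  have pl := add_box_partition pm ak.
  have /irrP[l el] := specht_char_irr (ltnW mN) pl.
  rewrite el cfdot_irr; case: eqP => // li _.
  by exists (add_box k mu); rewrite // ei el li.
have ind' mu : is_partition m.+1 mu -> 'Ind[symb m.+2] (specht_char m.+1 mu) =
    \sum_(i < m.+2 | addable mu i) specht_char m.+2 (add_box i mu).
  move=> pm; apply: specht_char_Ind => //.
  rewrite cfnorm_Ind_symb // cfdot_specht_char ?(ltnW mN) // eqxx res // sum_addable.
  rewrite (@cfnorm_sum_specht_char m m.+1 (fun i => rem_box i mu)) ?mulrS ?addr0 //.
  - by rewrite ltnW // ltnW.
  - by move=> i; apply: rem_box_partition.
  - move=> i j ri rj e; have := congr1 (nth 0%N ^~ i) e.
    rewrite !(nth_rem_box _ pm) // eqxx; case: eqP => // _.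
    by move: ri; rewrite /removable; lia.
by split=> // lam pl; apply: specht_char_Res.
Qed.

End Branching.

(** * The eigenvalue as an alternating sum *)

(* For lam a partition of n, this is the number of standard Young tableaux of
   skew shape lam / (n - j). *)
Fixpoint strip j lam : nat :=
  if j is j'.+1 then \sum_(i < size lam | removable lam i) strip j' (rem_box i lam)
  else (size lam <= 1)%N.

Section Eigenvalue.

Variable N : nat.
Implicit Types (m k : nat) (lam mu : seq nat) (s : 'S_N).
Local Notation symb m := (perm.Sym_group (below N m)).
Local Notation X := (specht_char N).

Lemma removable_size lam i : removable lam i -> (i < size lam)%N.
Proof. by rewrite /removable; case: (ltnP i (size lam)) => // le; rewrite [X in (_ < X)%N]nth_default. Qed.

Lemma sum_removable (R : nmodType) m lam (F : nat -> R) : (size lam <= m)%N ->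
  \sum_(i < m | removable lam i) F i = \sum_(i < size lam | removable lam i) F i.
Proof.
move=> sm; rewrite (big_ord_widen_cond _ (removable lam) F sm).
by apply: eq_bigl => i; case: (boolP (removable _ _)) => // /removable_size ->.
Qed.

Definition one_row k := if k is 0%N then [::] else [:: k].

Lemma one_row_partition k : is_partition k (one_row k).
Proof. by case: k => // k; rewrite /is_partition /= addn0 eqxx. Qed.

Lemma one_rowP k lam : is_partition k lam -> (lam == one_row k) = (size lam <= 1)%N.
Proof.
move=> pl; apply/eqP/idP => [->|]; first by case: k {pl}.
by case: lam pl => [|[|x] [|//]] /and3P[_ x0 /= /eqP <-] _ //; rewrite addn0.
Qed.

(** The row group is everything and the column group trivial, so the product with the trivial
    character is 1; both are irreducible. *)
Lemma specht_char_one_row k : (k <= N)%N -> X k (one_row k) = 1.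
Proof.
move=> kN; have pl := one_row_partition k; have yp := young_pair_tab kN pl.
have RH : rowG N k (one_row k) = symb k.
  apply/val_inj/eqP; rewrite eqEsubset subsetIl; apply/subsetP=> s Hs.
  apply/rowGP; split=> // x xk.
  have r0 (y : 'I_N) : (y < k)%N -> reshape_index (one_row k) y = 0%N.
    move=> yk; have := @reshape_indexP (one_row k) y.
    by case/and3P: pl => _ _ /eqP ->; rewrite yk; case: (k) yk => // k' _ /(_ isT) /=; case: reshape_index.
  by rewrite !r0 ?Sym_below_lt.
have C1 : colG N k (one_row k) = 1%G.
  case: yp => _ sCH RC _; apply/val_inj; rewrite /= -RC RH; apply/esym/setIidPr.
  exact: sCH.
have sgn1 : (-1) ^+ odd_perm (1%g : 'S_N) = 1 :> algC by rewrite odd_perm1.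
have yc x : x \in symb k -> ycoef (@odd_perm _) (rowG N k (one_row k)) (colG N k (one_row k)) x = 1.
  move=> Hx; rewrite -[x]mulg1 (ycoef_prod yp) ?RH ?sgn1 //; exact: group1.
have kE : young_kappa (@odd_perm _) (rowG N k (one_row k)) (colG N k (one_row k)) = #|symb k|%:R.
  rewrite /young_kappa {1}C1 big_set1 {1}RH.
  rewrite (eq_bigr (fun=> 1)) ?sumr_const // => p Hp.
  by rewrite sgn1 mul1r mul1g yc.
have d1 : '[X k (one_row k), 1] = 1.
  rewrite (cfdot_young_char (@odd_permM _) yp (cfun1_char _)) kE.
  rewrite (eq_bigr (fun=> 1)) => [|x Hx]; last by rewrite yc // cfun1E Hx mulr1.
  by rewrite sumr_const mulVf ?neq0CG.
have /irrP[i ei] := specht_char_irr kN pl; have /irrP[j ej] := cfun1_irr (symb k).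
move: d1; rewrite ei ej cfdot_irr; case: eqP => [-> //|_] /eqP.
by rewrite eq_sym oner_eq0.
Qed.

Lemma cfdot_Res_specht_char k j lam : (k + j <= N)%N -> is_partition (k + j) lam ->
  '['Res[symb k] (X (k + j) lam), 1] = (strip j lam)%:R.
Proof.
elim: j lam => [|j IH] lam.
  rewrite addn0 => kN pl; rewrite cfRes_id -(specht_char_one_row kN).
  by rewrite cfdot_specht_char ?one_row_partition // one_rowP.
rewrite addnS => kN pl; have [_ _ res] := branching kN.
rewrite -(@cfResRes _ _ (symb (k + j))) ?Sym_belowS ?leq_addr // res //.
rewrite raddf_sum cfdot_suml natr_sum.
rewrite (sum_removable (fun i => '['Res[symb k] (X (k + j) (rem_box i lam)), 1])
  (partition_size_le pl)).
apply: eq_bigr => i ri; rewrite IH //; first exact: ltnW.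
exact: rem_box_partition.
Qed.

(** The groups [symb N] and [[set: 'S_N]] agree, but their class functions have different types;
    hence a comparison of values. *)
Lemma chiE lam s : is_partition N lam -> chi N lam s = X N lam s.
Proof.
move=> pl; have yp := young_pair_tab (leqnn N) pl.
have HT : symb N = [set: 'S_N]%G by apply: val_inj; apply: Sym_belowT.
have rowE p : (p \in row_stab N lam) = (p \in rowG N N lam).
  by rewrite [RHS]in_setI HT in_setT /= !inE.
have colE p : (p \in col_stab N lam) = (p \in colG N N lam).
  by rewrite [RHS]in_setI HT in_setT /= !inE.
have -> : chi N lam = young_char (@odd_perm _) [set: 'S_N]%G (rowG N N lam) (colG N N lam).
  rewrite /chi /specht_repr /young_char.
  suff -> : young_symmetrizer N lam = \sum_(p in rowG N N lam) \sum_(q in colG N N lam)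
    (-1) ^+ odd_perm q *: delta_mx 0 (gring_index [set: 'S_N]%G (p * q)%g) by [].
  by apply: eq_big => [p|p _]; [apply: rowE|apply: eq_bigl => q; apply: colE].
have ypT : young_pair (@odd_perm _) [set: 'S_N]%G (rowG N N lam) (colG N N lam).
  by rewrite -HT.
rewrite (young_charE (@odd_permM _) ypT) ?inE //.
by rewrite /specht_char (young_charE (@odd_permM _) yp) HT ?inE.
Qed.

(** Inclusion-exclusion: the sum is f times the binomial expansion of (1 - 1)^(f - 1). *)
Lemma sum_ffact_eq1 f : (f <= N)%N ->
  \sum_(j < N) (-1) ^+ j / (j`!)%:R * (f ^_ j.+1)%:R = (f == 1%N)%:R :> algC.
Proof.
case: f => [|f] fN; first by apply: big1 => j _; rewrite ffact0n mulr0.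
have E (j : nat) : (-1) ^+ j / (j`!)%:R * (f.+1 ^_ j.+1)%:R = f.+1%:R * ((-1) ^+ j * 'C(f, j)%:R) :> algC.
  rewrite ffactSS -bin_ffact !natrM.
  have : (j`!)%:R != 0 :> algC by rewrite pnatr_eq0 -lt0n fact_gt0.
  by move=> h; field.
rewrite (eq_bigr _ (fun (j : 'I_N) _ => E j)) -mulr_sumr.
have -> : \sum_(j < N) (-1) ^+ j * 'C(f, j)%:R = (1 - 1 : algC) ^+ f.
  rewrite exprBn (big_ord_widen N (fun i => (-1) ^+ i * 1 ^+ (f - i) * 1 ^+ i *+ 'C(f, i)) fN).
  rewrite [RHS]big_mkcond /=; apply: eq_bigr => j _.
  rewrite !expr1n !mulr1 ltnS; case: leqP => fj; first by rewrite mulr_natr.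
  by rewrite bin_small // mulr0.
by rewrite subrr expr0n; case: f fN {E} => [|f] _; rewrite ?mulr1 ?mulr0.
Qed.

(** Each falling factorial of the number of fixed points is a character induced from the trivial
    one, and Frobenius reciprocity turns its product with chi into a multiplicity. *)
Lemma sum_fixing_chi lam : is_partition N lam ->
  \sum_(s in fixing_perms N 1) chi N lam s =
    (N`!)%:R * \sum_(j < N) (-1) ^+ j / (j`!)%:R * (strip j.+1 lam)%:R.
Proof.
move=> pl; have HT s : s \in symb N by rewrite (Sym_belowT N) inE.
have -> : \sum_(s in fixing_perms N 1) chi N lam s = \sum_(s in symb N)
   \sum_(j < N) (-1) ^+ j / (j`!)%:R * (X N lam s * (fixc N s ^_ j.+1)%:R).
  rewrite big_mkcond [RHS]big_mkcond /=; apply: eq_bigr => s _.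
  rewrite HT inE chiE //.
  have -> : \sum_(j < N) (-1) ^+ j / (j`!)%:R * (X N lam s * (fixc N s ^_ j.+1)%:R)
     = X N lam s * (fixc N s == 1%N)%:R.
    rewrite -sum_ffact_eq1; last by rewrite -[X in (_ <= X)%N]card_ord max_card.
    by rewrite mulr_sumr; apply: eq_bigr => j _; rewrite mulrCA.
  have -> : #|[set i | s i == i]| = fixc N s.
    by apply: eq_card => x; rewrite !inE ltn_ord.
  by case: (_ == _); rewrite ?mulr1 ?mulr0.
rewrite exchange_big mulr_sumr; apply: eq_bigr => j _ /=.
rewrite -mulr_sumr mulrCA; congr (_ * _).
have jN : (N - j.+1 + j.+1 = N)%N by rewrite subnK.
have := @cfdot_Res_specht_char (N - j.+1) j.+1 lam; rewrite jN => /(_ (leqnn _) pl) e.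
have : '[X N lam, 'Ind[symb N, symb (N - j.+1)] 1] = (strip j.+1 lam)%:R.
  by rewrite cfdotC -Frobenius_reciprocity cfdotC e !conjC_nat.
have cardN : #|symb N| = N`!.
  by rewrite -card_Sn -cardsT; apply: eq_card => s; rewrite HT inE.
move=> <-; rewrite cfdotE cardN mulVKf ?pnatr_eq0 -?lt0n ?fact_gt0 //.
apply: eq_bigr => s Hs.
by rewrite cfInd_cfun1_symb ?leq_subr // conjC_nat subKn.
Qed.

End Eigenvalue.

(** * Counting skew tableaux *)

Section Strip.

Implicit Types (i j k L M : nat) (lam nu : seq nat).
Local Open Scope nat_scope.

(** All of [nu] must go before one row is left, so [i] is the number of boxes taken from the first
    row. *)
Definition strip_below i L nu := strip (sumn nu + i) (L :: nu).
Local Notation G := strip_below.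

Lemma rem_box_cons i L nu : rem_box i.+1 (L :: nu) = L :: rem_box i nu.
Proof. by rewrite /rem_box /=; case: ifP. Qed.

Lemma strip_cons j L nu : strip j.+1 (L :: nu) =
  (if nth 0 nu 0 < L then strip j (rem_box 0 (L :: nu)) else 0) +
  \sum_(i < size nu | removable nu i) strip j (L :: rem_box i nu).
Proof.
rewrite [LHS]/= big_mkcond big_ord_recl /=; congr (_ + _).
rewrite [RHS]big_mkcond; apply: eq_bigr => i _.
by rewrite rem_box_cons.
Qed.

Lemma partition_cons M L nu : is_partition M nu -> nth 0 nu 0 <= L -> 0 < L ->
  is_partition (L + M) (L :: nu).
Proof.
move=> /is_partitionP[s l0 e] h L0; apply/is_partitionP; split=> [[|i]|[|i]|] //=; first exact: l0.
by rewrite e.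
Qed.

Lemma is_partition0 nu : is_partition 0 nu -> nu = [::].
Proof. by move/partition_size_le; case: nu. Qed.

Lemma partition_head_gt0 M nu : is_partition M.+1 nu -> 0 < nth 0 nu 0.
Proof. by move=> pn; rewrite -(partition_size _ pn); case: nu pn. Qed.

Lemma rem_box_head M nu i : is_partition M nu -> removable nu i ->
  nth 0 (rem_box i nu) 0 = if i == 0 then (nth 0 nu 0).-1 else nth 0 nu 0.
Proof. by move=> pn ri; rewrite (nth_rem_box _ pn ri) eq_sym; case: eqP => [->|]. Qed.

Lemma rem_box_head_le M nu i : is_partition M nu -> removable nu i ->
  nth 0 (rem_box i nu) 0 <= nth 0 nu 0.
Proof. by move=> pn ri; rewrite (rem_box_head pn ri); case: eqP => // _; apply: leq_pred. Qed.

Lemma sumn_partition M nu : is_partition M nu -> sumn nu = M.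
Proof. by case/is_partitionP. Qed.

Lemma strip_lt j L M nu : is_partition M nu -> nth 0 nu 0 <= L -> 0 < L -> j < M ->
  strip j (L :: nu) = 0.
Proof.
elim: j L M nu => [|j IH] L M nu pn hL L0 jM.
  by case: nu pn {hL} => [|x nu] // /sumn_partition e; rewrite -e in jM.
case: M pn jM => // M pn jM.
have h0 := partition_head_gt0 pn.
rewrite strip_cons big1 ?addn0 => [|i ri]; last first.
  apply: (IH _ M) => //; first exact: rem_box_partition.
  exact: leq_trans (rem_box_head_le pn ri) hL.
case: ifP => // hL'; rewrite /rem_box /=; case: eqP => [L1|L1]; first by lia.
by apply: (IH _ M.+1) => //; lia.
Qed.

Lemma strip_belowS0 L M nu : is_partition M.+1 nu -> nth 0 nu 0 <= L ->
  G 0 L nu = \sum_(i < size nu | removable nu i) G 0 L (rem_box i nu).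
Proof.
move=> pn hL; have h0 := partition_head_gt0 pn.
rewrite /G (sumn_partition pn) addn0 strip_cons.
have -> : (if nth 0 nu 0 < L then strip M (rem_box 0 (L :: nu)) else 0) = 0.
  case: ifP => // hL'; rewrite /rem_box /=; case: eqP => [L1|L1]; first by lia.
  by apply: (strip_lt pn) => //; lia.
rewrite add0n; apply: eq_bigr => i ri.
by rewrite (sumn_partition (rem_box_partition pn ri)) addn0.
Qed.

Lemma strip_belowS i L M nu : is_partition M.+1 nu -> nth 0 nu 0 <= L ->
  G i.+1 L nu = (if nth 0 nu 0 < L then G i L.-1 nu else 0) +
    \sum_(r < size nu | removable nu r) G i.+1 L (rem_box r nu).
Proof.
move=> pn hL; have h0 := partition_head_gt0 pn.
rewrite /G (sumn_partition pn) addnS strip_cons; congr (_ + _).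
  case: ifP => // hL'; rewrite /rem_box /=; case: eqP => [L1|//]; first by lia.
apply: eq_bigr => r rr.
by rewrite (sumn_partition (rem_box_partition pn rr)) addSnnS.
Qed.

Lemma strip_below_nil i L : i <= L -> 0 < L -> G i L [::] = 1.
Proof.
rewrite /G add0n; elim: i L => [|i IH] L // iL L0.
rewrite strip_cons /= L0 big_ord0 addn0 /rem_box /=; case: eqP => [L1|L1].
  by case: i iL {IH} => //; rewrite L1.
by rewrite /= IH //; lia.
Qed.

Lemma removable_ex M nu : is_partition M.+1 nu ->
  exists r : 'I_(size nu), removable nu r.
Proof.
move=> pn; have s0 : 0 < size nu by rewrite (partition_size _ pn) (partition_head_gt0 pn).
have rl : (size nu).-1 < size nu by rewrite prednK.
exists (Ordinal rl); rewrite /removable /= prednK // nth_default //.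
by rewrite -(partition_size _ pn).
Qed.

Lemma strip_below_gt0 i L M nu : is_partition M nu -> nth 0 nu 0 <= L -> 0 < L -> i <= L ->
  0 < G i L nu.
Proof.
elim: M nu => [|M IH] nu pn hL L0 iL.
  by rewrite (is_partition0 pn) strip_below_nil.
have [r rr] := removable_ex pn.
have pos : 0 < \sum_(r < size nu | removable nu r) G i L (rem_box r nu).
  rewrite (bigD1 r) //= ltn_addr // IH //; first exact: rem_box_partition.
  exact: leq_trans (rem_box_head_le pn rr) hL.
case: i {IH} iL pos => [|i] iL pos; first by rewrite (strip_belowS0 pn).
by rewrite (strip_belowS _ pn) // ltn_addl.
Qed.

(** Both sides count the standard tableaux of shape [nu]. *)
Lemma strip_below0_indep L L' M nu : is_partition M nu ->
  nth 0 nu 0 <= L -> 0 < L -> nth 0 nu 0 <= L' -> 0 < L' -> G 0 L nu = G 0 L' nu.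
Proof.
elim: M nu => [|M IH] nu pn hL L0 hL' L0'.
  by rewrite (is_partition0 pn) !strip_below_nil.
rewrite !(strip_belowS0 pn) //; apply: eq_bigr => r rr.
have hr := rem_box_head_le pn rr.
by apply: IH; rewrite ?(rem_box_partition pn rr) // (leq_trans hr).
Qed.

(** The one removal from the first row may take place at any of M + 1 moments if nu_1 < L; if nu_1 =
    L it cannot be the first. *)
Lemma strip_below1 L M nu : is_partition M nu -> nth 0 nu 0 <= L -> 0 < L ->
  if nth 0 nu 0 < L then G 1 L nu = M.+1 * G 0 L nu else G 1 L nu <= M * G 0 L nu.
Proof.
elim: M nu => [|M IH] nu pn hL L0.
  by rewrite (is_partition0 pn) /= L0 !strip_below_nil.
rewrite (strip_belowS _ pn) //; case: (boolP (nth 0 nu 0 < L)) => hL'.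
  have h0 := partition_head_gt0 pn.
  rewrite (@strip_below0_indep L.-1 L _ _ pn) //; try lia.
  rewrite mulSn; congr (_ + _).
  rewrite (strip_belowS0 pn) // big_distrr /=; apply: eq_bigr => r rr.
  have hr := leq_ltn_trans (rem_box_head_le pn rr) hL'.
  by have := IH _ (rem_box_partition pn rr) (ltnW hr) L0; rewrite hr.
rewrite add0n (strip_belowS0 pn) // big_distrr /=; apply: leq_sum => r rr.
have hr := leq_trans (rem_box_head_le pn rr) hL.
have := IH _ (rem_box_partition pn rr) hr L0; case: ifP => [_ -> //|_ le].
by apply: leq_trans le _; rewrite leq_mul2r leqnSn orbT.
Qed.

Lemma strip_below1_le L M nu : is_partition M nu -> nth 0 nu 0 <= L -> 0 < L ->
  G 1 L nu <= M.+1 * G 0 L nu.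
Proof.
move=> pn hL L0; have := strip_below1 pn hL L0; case: ifP => [_ -> //|_ le].
by apply: leq_trans le _; rewrite leq_mul2r leqnSn orbT.
Qed.

(** The factor M + i is the ratio of consecutive factorials in [bterm], so this is the monotonicity
    of the b_i. At i = 0 it fails when nu_1 < L. *)
Lemma strip_below_le i L M nu : is_partition M nu -> nth 0 nu 0 <= L ->
  0 < i -> i < L -> G i.+1 L nu <= (M + i) * G i L nu.
Proof.
case: i => // i pn hL _ iL.
(* The same factor M + j + 1 moves from j, where it is weak, to j + 1, where it is sharp: removals
   from the first row use the weak bound, the others induction on M. A sharp bound is also a weak
   one, so the step iterates. *)
suff step (j : nat) : (forall L M nu, is_partition M nu -> nth 0 nu 0 <= L -> 0 < L ->
      j < L -> G j.+1 L nu <= (M + j.+1) * G j L nu) ->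
    forall L M nu, is_partition M nu -> nth 0 nu 0 <= L -> j.+1 < L ->
      G j.+2 L nu <= (M + j.+1) * G j.+1 L nu.
  elim: i L M nu pn hL iL => [|i IHi]; apply: step => L M nu pn hL L0 iL.
    by rewrite addn1; apply: strip_below1_le.
  by apply: leq_trans (IHi _ _ _ pn hL iL) _; rewrite leq_mul2r; apply/orP; right; lia.
move=> {i iL pn hL L M nu} weak L M nu; elim: M nu => [|M IH] nu pn hL jL.
  by rewrite (is_partition0 pn) !strip_below_nil //; lia.
have h0 := partition_head_gt0 pn.
rewrite (@strip_belowS j.+1 L _ _ pn) // (@strip_belowS j L _ _ pn) // mulnDr.
apply: leq_add.
  by case: ifP => // hL'; apply: (weak _ _ _ pn); lia.
rewrite big_distrr /=; apply: leq_sum => r rr.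
have hr := leq_trans (rem_box_head_le pn rr) hL.
apply: leq_trans (IH _ (rem_box_partition pn rr) hr jL) _.
by rewrite leq_mul2r addSn leqnSn orbT.
Qed.

(** After M removals a single box is left, and it can go in only one way. *)
Lemma strip_sumn M lam : is_partition M.+1 lam -> strip M.+1 lam = strip M lam.
Proof.
elim: M lam => [|M IH] lam pl.
  have h0 := partition_head_gt0 pl; have := partition_size_le pl.
  case: lam pl h0 => [|x [|//]] // pl h0 _.
  have := sumn_partition pl; rewrite /= addn0 => ->.
  by rewrite big_mkcond big_ord_recl big_ord0.
rewrite [LHS]/= [RHS]/=; apply: eq_bigr => i ri.
exact: (IH _ (rem_box_partition pl ri)).
Qed.

Lemma strip_below_last L M nu : is_partition M nu -> nth 0 nu 0 <= L -> 0 < L ->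
  G L L nu = G L.-1 L nu.
Proof.
move=> pn hL; case: L hL => // L hL _; rewrite /G (sumn_partition pn) addnS.
by apply: strip_sumn; have := partition_cons pn hL isT; rewrite addSn addnC.
Qed.

(** The binomial counts all interleavings of i removals in the first row with M removals below; some
    may be forbidden. The recursion is Pascal's rule. *)
Lemma strip_below_bin_le i L M nu : is_partition M nu -> nth 0 nu 0 <= L -> 0 < L -> i <= L ->
  G i L nu <= 'C(M + i, i) * G 0 L nu.
Proof.
elim: i L M nu => [|i IHi] L M nu; first by rewrite addn0 bin0 mul1n.
elim: M nu => [|M IH] nu pn hL L0 iL.
  by rewrite (is_partition0 pn) !strip_below_nil // add0n binn.
have h0 := partition_head_gt0 pn.
rewrite (strip_belowS _ pn) // addnS binS mulnDl [leqRHS]addnC; apply: leq_add.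
  case: ifP => // hL'; rewrite (@strip_below0_indep L L.-1 _ _ pn) //; try lia.
  by apply: IHi => //; lia.
rewrite (strip_belowS0 pn) // big_distrr /=; apply: leq_sum => r rr.
have hr := leq_trans (rem_box_head_le pn rr) hL.
by have := IH _ (rem_box_partition pn rr) hr L0 iL; rewrite addSnnS.
Qed.

(** The first row never becomes shorter than nu_1, so every interleaving is allowed. *)
Lemma strip_below_bin i L M nu : is_partition M nu -> nth 0 nu 0 + i <= L -> 0 < L ->
  G i L nu = 'C(M + i, i) * G 0 L nu.
Proof.
elim: i L M nu => [|i IHi] L M nu; first by rewrite addn0 bin0 mul1n.
elim: M nu => [|M IH] nu pn hL L0.
  by rewrite (is_partition0 pn) !strip_below_nil // ?add0n ?binn //; lia.
have h0 := partition_head_gt0 pn.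
have hL' : nth 0 nu 0 < L by lia.
rewrite (strip_belowS _ pn) ?hL' 1?ltnW // addnS binS mulnDl [RHS]addnC; congr (_ + _).
  rewrite (@strip_below0_indep L L.-1 _ _ pn) //; try lia.
  by apply: IHi => //; lia.
rewrite (strip_belowS0 pn) 1?ltnW // big_distrr /=; apply: eq_bigr => r rr.
have hr := rem_box_head_le pn rr.
by have := IH _ (rem_box_partition pn rr) _ L0; rewrite addSnnS => -> //; lia.
Qed.

End Strip.

(** * First row one box longer than the second *)

Section StripHead.

Implicit Types (i j k L M : nat) (lam nu : seq nat).
Local Open Scope nat_scope.
Local Notation G := strip_below.

Lemma sum_removable_head M nu (F : seq nat -> nat) : is_partition M.+1 nu ->
  \sum_(r < size nu | removable nu r) F (rem_box r nu) =
  (if removable nu 0 then F (rem_box 0 nu) else 0) +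
  \sum_(r < size nu | removable nu r && (0 < r)) F (rem_box r nu).
Proof.
move=> pn; have s0 : 0 < size nu by rewrite (partition_size _ pn) (partition_head_gt0 pn).
case: ifP => r0; last first.
  by apply: eq_bigl => r; case: (val r =P 0) => [->|/eqP]; rewrite ?r0 // -lt0n => ->; rewrite andbT.
rewrite (bigD1 (Ordinal s0)) //=; congr (_ + _); apply: eq_bigl => r.
by rewrite -val_eqE /= -lt0n.
Qed.

Lemma bin2_mul M : 2 * 'C(M + 2, 2) = M.+2 * M.+1.
Proof. by rewrite mulnC -[2 in X in X = _]/(2`!) bin_ffact addn2 !ffactnS ffactn0 muln1. Qed.

Lemma bin3_mul M : 6 * 'C(M + 3, 3) = M.+3 * M.+2 * M.+1.
Proof. by rewrite mulnC -[6]/(3`!) bin_ffact addn3 !ffactnS ffactn0 muln1 mulnA. Qed.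

(* The case where the first row is just one box longer than the second one.
   All four inequalities are preserved by the removal of a box of [nu] outside its
   first row; after a removal from its first row all terms are known or bounded
   by [strip_below_bin] and [strip_below_bin_le]. *)
Lemma strip_head w M nu (y := G 1 w nu) (y2 := G 2 w.+1 nu) :
    is_partition M nu -> nth 0 nu 0 = w -> 1 < w ->
  [/\ 2 * G 0 w.+1 nu <= y,
      M.+1 * y + 2 * (M * G 0 w.+1 nu) <= 2 * y2,
      G 2 w nu + y2 <= M.+2 * y &
      G 3 w.+1 nu + M.+1 * y2 <= M.+1 * (M.+2 * y)].
Proof.
rewrite {}/y {}/y2; elim: M nu => [|M IH] nu pn hw w1.
  by rewrite (is_partition0 pn) in hw; rewrite -hw in w1.
set Q := fun r : 'I_(size nu) => removable nu r && (0 < r).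
have E (F : seq nat -> nat) : \sum_(r < size nu | removable nu r) F (rem_box r nu) =
  (if removable nu 0 then F (rem_box 0 nu) else 0) + \sum_(r | Q r) F (rem_box r nu).
  exact: (sum_removable_head _ pn).
have IHr (r : 'I_(size nu)) : Q r -> is_partition M (rem_box r nu) /\ nth 0 (rem_box r nu) 0 = w.
  move=> /andP[rr r0]; split; first exact: rem_box_partition.
  by rewrite (rem_box_head pn rr); case: eqP r0 => // ->.
have S1 : 2 * (\sum_(r | Q r) G 0 w.+1 (rem_box r nu)) <= \sum_(r | Q r) G 1 w (rem_box r nu).
  by rewrite big_distrr /=; apply: leq_sum => r /IHr[pr hr]; case: (IH _ pr hr w1).
have S2 : M.+1 * (\sum_(r | Q r) G 1 w (rem_box r nu)) + 2 * (M * \sum_(r | Q r) G 0 w.+1 (rem_box r nu))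
    <= 2 * \sum_(r | Q r) G 2 w.+1 (rem_box r nu).
  rewrite !big_distrr -big_split /=; apply: leq_sum => r /IHr[pr hr].
  by case: (IH _ pr hr w1).
have S3 : \sum_(r | Q r) G 2 w (rem_box r nu) + \sum_(r | Q r) G 2 w.+1 (rem_box r nu)
    <= M.+2 * \sum_(r | Q r) G 1 w (rem_box r nu).
  rewrite !big_distrr -big_split /=; apply: leq_sum => r /IHr[pr hr].
  by case: (IH _ pr hr w1).
have S4 : \sum_(r | Q r) G 3 w.+1 (rem_box r nu) + M.+1 * \sum_(r | Q r) G 2 w.+1 (rem_box r nu)
    <= M.+1 * (M.+2 * \sum_(r | Q r) G 1 w (rem_box r nu)).
  rewrite !big_distrr -big_split /=; apply: leq_sum => r /IHr[pr hr].
  by case: (IH _ pr hr w1).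
have hw' : nth 0 nu 0 <= w.+1 by rewrite hw.
rewrite (strip_belowS0 pn) // (@strip_belowS 1 w.+1 _ _ pn) //.
rewrite (@strip_belowS 2 w.+1 _ _ pn) // hw ltnSn /=.
rewrite (@strip_belowS 1 w _ _ pn) ?hw // (@strip_belowS 0 w _ _ pn) ?hw // ltnn !add0n.
rewrite (E (G 0 w.+1)) (E (G 1 w)) (E (G 2 w)) (E (G 2 w.+1)) (E (G 3 w.+1)).
have [xz [e1 e2 e3 e4 e5]] : exists xz : nat,
  [/\ (if removable nu 0 then G 0 w.+1 (rem_box 0 nu) else 0) = xz,
      (if removable nu 0 then G 1 w (rem_box 0 nu) else 0) = M.+1 * xz,
      2 * (if removable nu 0 then G 2 w.+1 (rem_box 0 nu) else 0) = M.+2 * M.+1 * xz,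
      2 * (if removable nu 0 then G 2 w (rem_box 0 nu) else 0) <= M.+2 * M.+1 * xz &
      6 * (if removable nu 0 then G 3 w.+1 (rem_box 0 nu) else 0) <= M.+3 * M.+2 * M.+1 * xz].
  case: ifP => r0; last by exists 0; rewrite !muln0.
  have pr := rem_box_partition pn r0; have hr := rem_box_head pn r0; rewrite hw /= in hr.
  have w0 : 0 < w by lia.
  exists (G 0 w.+1 (rem_box 0 nu)); split=> //.
  - have /= := strip_below1 pr (L := w); rewrite hr prednK // leqnn leq_pred => /(_ isT w0) ->.
    by congr (_ * _); apply: (strip_below0_indep pr); lia.
  - by rewrite (strip_below_bin pr) ?mulnA ?bin2_mul //; lia.
  - rewrite -bin2_mul -mulnA leq_mul2l /=.
    by rewrite (@strip_below0_indep w.+1 w _ _ pr) ?(strip_below_bin_le pr) //; lia.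
  - by rewrite -bin3_mul -mulnA leq_mul2l /= (strip_below_bin_le pr) //; lia.
rewrite e1 e2; move: e3 e4 e5 S1 S2 S3 S4.
move: (if _ then G 2 w.+1 _ else 0) (if _ then G 2 w _ else 0) (if _ then G 3 w.+1 _ else 0) => a b c.
move: (\sum_(r | Q r) G 0 _ _) (\sum_(r | Q r) G 1 _ _) (\sum_(r | Q r) G 2 w _) (\sum_(r | Q r) G 2 _ _)
  (\sum_(r | Q r) G 3 _ _) => Sx Sy Su Sy2 S3 ea eb ec H1 H2 H3 H4.
have M1 : 0 < M.
  by have := nth_sumn_le nu 0; rewrite (sumn_partition pn) hw; lia.
have xzM : xz <= M * xz by rewrite leq_pmull.
by split; nia.
Qed.

End StripHead.

(** * Signs *)

Section Signs.

Implicit Types (i j k L M n : nat) (lam nu : seq nat).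
Local Notation G := strip_below.

Definition alt (b : nat -> rat) n i : rat := \sum_(k < n.+1) (-1) ^+ k * b (i + k)%N.

Lemma altS b n i : alt b n.+1 i = b i - alt b n i.+1.
Proof.
rewrite /alt big_ord_recl expr0 mul1r addn0; congr (_ + _).
rewrite -sumrN; apply: eq_bigr => k _; rewrite /= /bump /= exprS mulN1r mulNr.
by rewrite addnCA addSn add0n.
Qed.

Lemma alt0 b i : alt b 0 i = b i.
Proof. by rewrite /alt big_ord_recl big_ord0 expr0 mul1r !addr0 addn0. Qed.

(** Leibniz criterion; the strict drop at the last step makes both bounds strict. *)
Lemma alt_bounds b n i :
    (forall k, (i <= k < i + n)%N -> b k.+1 <= b k) -> 0 < b (i + n)%N ->
    ((0 < n)%N -> b (i + n)%N < b (i + n).-1) ->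
  0 < alt b n i /\ ((0 < n)%N -> alt b n i < b i).
Proof.
elim: n i => [|n IH] i dec pos str; first by rewrite alt0; rewrite addn0 in pos.
case: n IH dec pos str => [|n] IH dec pos str.
  rewrite altS alt0; have := str isT; move: pos; rewrite addn1 /= => pos.
  by rewrite subr_gt0 => ->; rewrite ltrBlDr ltrDl.
have [] := IH i.+1.
- by move=> k ik; apply: dec; lia.
- by rewrite addSnnS.
- by move=> _; rewrite addSnnS; apply: str.
move=> p /(_ isT) lt; rewrite altS; split; last by rewrite ltrBlDr ltrDl.
by rewrite subr_gt0 (lt_le_trans lt) // dec //; lia.
Qed.

(** Taken over [rat], whose order is total, and carried to [algC] by [ratr]. *)
Definition eta_sum n lam : rat := \sum_(j < n) (-1) ^+ j / (j`!)%:R * (strip j.+1 lam)%:R.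

(** Here |nu| = m + 1: the multiplicity with index j + 1 is divided by j!, and j = m + i. *)
Definition bterm m L nu i : rat := (G i L nu)%:R / ((m + i)`!)%:R.

Lemma factr_neq0 n : (n`!)%:R != 0 :> rat.
Proof. by rewrite pnatr_eq0 -lt0n fact_gt0. Qed.

Lemma factr_gt0 n : 0 < (n`!)%:R :> rat.
Proof. by rewrite ltr0n fact_gt0. Qed.

Lemma eta_sum_alt m L nu : is_partition m.+1 nu -> (nth 0 nu 0 <= L)%N -> (0 < L)%N ->
  eta_sum (L + m.+1) (L :: nu) = (-1) ^+ m * alt (bterm m L nu) L 0.
Proof.
move=> pn hL L0; rewrite /eta_sum (_ : (L + m.+1 = m + L.+1)%N); last by lia.
rewrite big_split_ord big1 => [|j _]; last first.
  by rewrite (strip_lt pn hL L0) ?mulr0 // ltnS; apply: (ltn_ord j).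
rewrite [LHS]add0r /alt mulr_sumr; apply: eq_bigr => i _.
rewrite [nat_of_ord (rshift _ _)]/= exprD /bterm add0n /strip_below (sumn_partition pn) addSn.
by rewrite -!mulrA; congr (_ * (_ * _)); rewrite mulrC.
Qed.

(** All multiplicities are 1, which leaves 1 - 1 + 1/2! - ... up to 1/(L - 1)!; at L = 2 this is
    0. *)
Lemma eta_sum_row L : (2 < L)%N -> 0 < eta_sum L [:: L].
Proof.
move=> L3; have -> : eta_sum L [:: L] = alt (fun j => ((j`!)%:R)^-1) L.-1 0.
  rewrite /eta_sum /alt prednK; last by lia.
  apply: eq_bigr => j _; rewrite add0n.
  have := @strip_below_nil j.+1 L (ltn_ord j) (leq_ltn_trans (leq0n _) (ltn_ord j)).
  by rewrite /strip_below add0n => ->; rewrite mulr1.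
case: L L3 => // L L3; have [] // := @alt_bounds (fun j => ((j`!)%:R)^-1 : rat) L 0.
- move=> k _; rewrite lef_pV2 ?posrE ?factr_gt0 // ler_nat factS leq_pmull //.
- by rewrite invr_gt0 factr_gt0.
move=> L0; rewrite ltf_pV2 ?posrE ?factr_gt0 // ltr_nat add0n.
by case: L L3 {L0} => // L L3; rewrite factS ltn_Pmull // fact_gt0.
Qed.

(** * Positivity of the alternating sum for one shape *)

Section Shape.

Variables (m L : nat) (nu : seq nat).
Hypotheses (pn : is_partition m.+1 nu) (hL : (nth 0 nu 0 <= L)%N).
Local Notation b := (bterm m L nu).
Local Notation x := (G 0 L nu).

Let h0 : (0 < nth 0 nu 0)%N. Proof. exact: partition_head_gt0 pn. Qed.
Let L0 : (0 < L)%N. Proof. exact: leq_trans h0 hL. Qed.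

Lemma bterm_gt0 i : (i <= L)%N -> 0 < b i.
Proof. by move=> iL; rewrite divr_gt0 ?factr_gt0 // ltr0n (strip_below_gt0 pn). Qed.

Lemma bterm_step i : (G i.+1 L nu <= (m + i).+1 * G i L nu)%N -> b i.+1 <= b i.
Proof.
move=> le; rewrite /bterm addnS factS natrM invfM mulrA ler_pM2r ?invr_gt0 ?factr_gt0 //.
by rewrite ler_pdivrMr ?ltr0n // -natrM ler_nat mulnC.
Qed.

Lemma bterm_last : (0 < m + L.-1)%N -> b L < b L.-1.
Proof.
move=> mL; rewrite /bterm (strip_below_last pn) //.
rewrite ltr_pM2l ?ltr0n ?(strip_below_gt0 pn) ?leq_pred //.
rewrite ltf_pV2 ?posrE ?factr_gt0 // ltr_nat -{2}(prednK L0) addnS factS.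
by rewrite ltn_Pmull ?fact_gt0.
Qed.

Lemma alt_tail i : (0 < i)%N -> (i <= L)%N -> (0 < m + L.-1)%N ->
  0 < alt b (L - i) i /\ alt b (L - i) i <= b i.
Proof.
move=> i0 iL mL; have [] := @alt_bounds b (L - i) i.
- move=> k; rewrite subnKC // => /andP[ik kL]; apply: bterm_step.
  by have := strip_below_le pn hL (leq_trans i0 ik) kL; rewrite addSn.
- by rewrite subnKC // bterm_gt0.
- by move=> _; rewrite subnKC // bterm_last.
move=> pos lt; split=> //; case: (posnP (L - i)%N) lt => [-> _|Li /(_ isT)/ltW //].
by rewrite alt0.
Qed.

(** When nu_1 = L, [strip_below1] has the factor M = m + 1, so the terms decrease from b_0 on. *)
Lemma alt_eq_head : nth 0%N nu 0 = L -> (0 < m + L.-1)%N -> 0 < alt b L 0.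
Proof.
move=> hL' mL; have [] // := @alt_bounds b L 0.
- move=> k /andP[_ kL]; rewrite add0n in kL; apply: bterm_step.
  case: k kL => [|k] kL.
    have := strip_below1 pn hL L0; rewrite hL' ltnn => le.
    by rewrite addn0.
  by have := strip_below_le pn hL (ltn0Sn k) kL; rewrite addSn.
- by rewrite bterm_gt0.
- by move=> _; rewrite bterm_last.
Qed.

(** The tail from index 3 is at most b_3; the hypothesis is b_0 - b_1 + b_2 - b_3 > 0 multiplied by
    (m + 3)!. *)
Lemma alt_four : (2 < L)%N ->
    ((m.+1 * m.+2 * m.+3 * x + m.+3 * G 2 L nu > m.+2 * m.+3 * G 1 L nu + G 3 L nu)%N) ->
  0 < alt b L 0.
Proof.
move=> L3 lt; have [|_ le3] := @alt_tail 3 isT L3; first by lia.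
have -> : alt b L 0 = b 0%N - b 1%N + b 2%N - alt b (L - 3) 3.
  have -> : alt b L 0 = alt b (L - 3).+3 0 by congr alt; lia.
  by rewrite !altS; ring.
apply: lt_le_trans (_ : b 0%N - b 1%N + b 2%N - b 3 <= _); last by rewrite lerB.
rewrite /bterm addn0 addn1 addn2 addn3 !factS !natrM.
have f0 := factr_gt0 m; move: (factr_neq0 m) => f1.
have [m1 m2 m3] : [/\ m.+1%:R != 0 :> rat, m.+2%:R != 0 :> rat & m.+3%:R != 0 :> rat].
  by rewrite !pnatr_eq0.
have e (a1 a2 a3 f g0 g1 g2 g3 : rat) : a1 != 0 -> a2 != 0 -> a3 != 0 -> f != 0 ->
    g0 / f - g1 / (a1 * f) + g2 / (a2 * (a1 * f)) - g3 / (a3 * (a2 * (a1 * f))) =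
    (a1 * a2 * a3 * g0 + a3 * g2 - (a2 * a3 * g1 + g3)) / (a3 * (a2 * (a1 * f))).
  by move=> *; field; apply/and4P.
rewrite e // divr_gt0 ?mulr_gt0 ?ltr0n ?fact_gt0 //.
by rewrite subr_gt0 -!natrM -!natrD ltr_nat.
Qed.

(** The terms G_1 and G_2 are exact binomial multiples of x, and G_3 is at most one. Divided by (m +
    2)(m + 3)x, the inequality becomes 2m > 1. *)
Lemma alt_far : ((nth 0 nu 0).+1 < L)%N -> (0 < m)%N -> 0 < alt b L 0.
Proof.
move=> hL' m0; apply: alt_four; first by lia.
have e1 := strip_below_bin pn (i := 1) _ L0.
have e2 := strip_below_bin pn (i := 2) _ L0.
have le3 : (G 3 L nu <= 'C(m.+1 + 3, 3) * x)%N by apply: (strip_below_bin_le pn) => //; lia.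
rewrite e1 ?e2 ?bin1; try lia.
have := bin2_mul m.+1; have := bin3_mul m.+1.
have x0 : (0 < x)%N by rewrite (strip_below_gt0 pn).
move: le3; move: ('C(_, 3)) ('C(_, 2)) => c3 c2.
rewrite addn1; nia.
Qed.

Lemma alt_near : (nth 0%N nu 0).+1 = L -> (2 < L)%N -> 0 < alt b L 0.
Proof.
move=> hL' L3; apply: alt_four => //.
have w1 : (1 < nth 0 nu 0)%N by lia.
have := strip_head pn erefl w1; rewrite hL' => -[H1 H2 H3 H4].
have := strip_below1 pn hL L0; rewrite -{1}hL' ltnSn => ->.
have hw : (0 < nth 0 nu 0)%N by [].
have := strip_below1 pn (leqnn _) hw; rewrite ltnn.
rewrite (@strip_below0_indep _ L _ _ pn) // => H5.
have x0 : (0 < x)%N by rewrite (strip_below_gt0 pn).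
have mh := nth_sumn_le nu 0; rewrite (sumn_partition pn) in mh.
(* Since nu_1 >= 2, m = 0 is impossible. At m = 1 the general estimate fails; the only shape is
   (3,2), treated through its recursion. *)
case: m pn mh H1 H2 H3 H4 H5 => [|[|m']] pn' mh H1 H2 H3 H4 H5; first by lia.
  have nuE : nu = [:: 2%N].
    have [_ p0 e] := is_partitionP _ _ pn'.
    case: (nu) p0 e mh w1 => [|a [|c t]] //= p0 e mh w1.
      by congr [:: _]; lia.
    by have /= := p0 1%N isT; lia.
  have L3' : L = 3%N by rewrite -hL' nuE.
  rewrite nuE L3'.
  have p2 := one_row_partition 2; have p1 := one_row_partition 1.
  have E i k : strip_below i.+1 k.+3 [:: 2%N] = (strip_below i k.+2 [:: 2%N] + strip_below i.+1 k.+3 [:: 1%N])%N.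
    by rewrite (strip_belowS _ p2) //= big_mkcond big_ord_recl big_ord0 /= addn0.
  have E2 i : strip_below i.+1 2 [:: 2%N] = strip_below i.+1 2 [:: 1%N].
    by rewrite (strip_belowS _ p2) //= big_mkcond big_ord_recl big_ord0 /= addn0.
  have E0 : strip_below 0 3 [:: 2%N] = strip_below 0 3 [:: 1%N].
    by rewrite (strip_belowS0 p2) //= big_mkcond big_ord_recl big_ord0 /= addn0.
  have e0 := strip_below0_indep p1 (L := 2) (L' := 3) isT isT isT isT.
  have e1 := strip_below_bin p1 (L := 2) (i := 1) isT isT.
  have e2 := strip_below_bin p1 (L := 3) (i := 2) isT isT.
  have e3 := strip_below_bin_le p1 (L := 2) (i := 2) isT isT isT.
  have e4 := strip_below_bin_le p1 (L := 3) (i := 3) isT isT isT.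
  have x1 := strip_below_gt0 p1 (L := 3) (i := 0) isT isT isT.
  rewrite !E !E2 E0; move: e0 e1 e2 e3 e4 x1; rewrite /one_row.
  have [-> -> ->] : [/\ 'C(1 + 1, 1) = 2, 'C(1 + 2, 2) = 3 & 'C(1 + 3, 3) = 4]%N by [].
  lia.
(* Let m = m' + 2, y = [G 1 (nth 0 nu 0) nu] and y2 = [G 2 L nu]. Eliminating [G 3 L nu] by [H4]
   leaves (2m + 5) y2 > (m + 2)(m + 3)(x + y). The bounds [H2] on y2 and [H5] on y reduce this to
   m^2 + m > 4. *)
have K1 : ((2 * m'.+3 + 3) * (m'.+4 * G 1 (nth 0 nu 0) nu + 2 * (m'.+3 * x))
   <= (2 * m'.+3 + 3) * (2 * G 2 L nu))%N by rewrite leq_mul2l H2 orbT.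
have K2 : (m'.+4 * G 1 (nth 0 nu 0) nu <= m'.+4 * (m'.+3 * x))%N by rewrite leq_mul2l H5 orbT.
nia.
Qed.

End Shape.

(** * The two exceptional shapes and the sign in general *)

Lemma alt_hook_row L : (0 < L)%N -> alt (bterm 0 L [:: 1%N]) L 0 = 0.
Proof.
case: L => // l _; have p1 := one_row_partition 1; set x := G 0 l.+1 [:: 1%N].
have bE i : (i <= l)%N -> bterm 0 l.+1 [:: 1%N] i = i.+1%:R / (i`!)%:R * x%:R.
  move=> il; rewrite /bterm (strip_below_bin p1) ?add1n //= -/x add0n.
  by rewrite binSn natrM mulrAC.
have bL : bterm 0 l.+1 [:: 1%N] l.+1 = (l.+1 * x)%:R / (l.+1`!)%:R.
  by rewrite /bterm (strip_below_last p1) //= (strip_below_bin p1) ?add1n //= binSn.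
rewrite /alt big_ord_recr /= add0n bL.
rewrite (eq_bigr (fun k : 'I_l.+1 => (-1) ^+ k * (k.+1%:R / (k`!)%:R) * x%:R)) => [|k _]; last first.
  by rewrite add0n bE ?mulrA // -ltnS.
rewrite -mulr_suml factS !natrM.
(* The partial sums telescope, and the last term of the alternating sum, with its shortened
   numerator, cancels what is left. *)
have -> : \sum_(k < l.+1) (-1) ^+ k * (k.+1%:R / (k`!)%:R) = (-1) ^+ l / (l`!)%:R :> rat.
  elim: l {x bE bL} => [|l IH]; first by rewrite big_ord_recl big_ord0 addr0.
  rewrite big_ord_recr IH /= factS natrM exprS; have := factr_neq0 l.
  have : l.+1%:R != 0 :> rat by rewrite pnatr_eq0.
  rewrite [l.+2%:R]mulrSr; move: (l.+1%:R) (_`!%:R) ((-1) ^+ l) => a f e a0 f0.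
  by field; apply/andP.
have := factr_neq0 l; have : l.+1%:R != 0 :> rat by rewrite pnatr_eq0.
rewrite exprS; move: (l.+1%:R) (_`!%:R) ((-1) ^+ l) => a f e a0 f0.
by field; apply/andP.
Qed.

(** Three terms remain, with G_2 = G_1 = (m + 2) G_0; their sum is a multiple of 1 - (m + 2)/(m + 1)
    + 1/(m + 1). *)
Lemma alt_hook_col m nu : is_partition m.+1 nu -> nth 0%N nu 0 = 1%N ->
  alt (bterm m 2 nu) 2 0 = 0.
Proof.
move=> pn h1; have hL : (nth 0%N nu 0 <= 2)%N by rewrite h1.
rewrite !altS alt0 /bterm (strip_below_last pn hL) //=.
have := strip_below1 pn hL isT; rewrite h1 /= => ->.
rewrite addn0 addn1 addn2 !factS !natrM.
have := factr_neq0 m; have : m.+1%:R != 0 :> rat by rewrite pnatr_eq0.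
have : m.+2%:R != 0 :> rat by rewrite pnatr_eq0.
rewrite [m.+2%:R]mulrSr; move: (m.+1%:R) (_`!%:R) => a f a2 a0 f0.
by field; apply/and3P.
Qed.

Lemma partition_ones M nu : is_partition M nu -> nth 0%N nu 0 = 1%N -> nu = nseq M 1%N.
Proof.
move=> pn h1; have [s l0 e] := is_partitionP _ _ pn.
have le1 i : (nth 0%N nu i <= 1)%N by elim: i => [|i IH]; [rewrite h1|apply: leq_trans (s i) IH].
have E : nu = nseq (size nu) 1%N.
  apply: (@eq_from_nth _ 0%N) => [|i il]; first by rewrite size_nseq.
  by rewrite nth_nseq il; have := le1 i; have := l0 i il; lia.
by have := e; rewrite {1}E sumn_nseq mul1n => <-.
Qed.

Lemma eta_sum_sign m L nu : is_partition m.+1 nu -> (nth 0%N nu 0 <= L)%N ->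
  if (nu == [:: 1%N]) || ((L == 2%N) && (nu == nseq m.+1 1%N))
  then eta_sum (L + m.+1) (L :: nu) = 0 else 0 < (-1) ^+ m * eta_sum (L + m.+1) (L :: nu).
Proof.
move=> pn hL; have h0 := partition_head_gt0 pn; have L0 := leq_trans h0 hL.
rewrite (eta_sum_alt pn hL L0) mulrA -expr2 sqrr_sign mul1r.
case: ifP => [/orP[/eqP e|/andP[/eqP L2 /eqP e]]|/negbT].
- have [m0] : m.+1 = 1%N by rewrite -(sumn_partition pn) e.
  by rewrite m0 e alt_hook_row ?mulr0.
- by rewrite L2 alt_hook_col ?mulr0 // e.
rewrite negb_or => /andP[n1 n2].
have m0 : (0 < m)%N.
  rewrite lt0n; apply: contra n1 => /eqP m0; rewrite m0 in pn.
  by rewrite -[[:: _]]/(one_row 1) one_rowP // partition_size_le.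
(* The three cases are nu_1 <= L - 2, nu_1 = L and nu_1 = L - 1. In the last one L = 2 would force
   [nu] to be a column, an excluded shape. *)
have [lt1|lt1|e1] := ltngtP (nth 0%N nu 0).+1 L; first exact: alt_far.
  by apply: (alt_eq_head pn hL); lia.
apply: (alt_near pn hL e1).
rewrite ltn_neqAle -e1 ltnS h0 andbT; apply: contra n2 => /eqP e2.
rewrite -e1 -e2 eqxx /=; apply/eqP.
by apply: (partition_ones pn); case: e2.
Qed.

End Signs.

(** * From the rational sum back to the eigenvalue *)

Lemma cells_under_first_rowE L nu : cells_under_first_row (L :: nu) = sumn nu.
Proof.
rewrite /cells_under_first_row /ferrers count_flatten -map_comp /=.
rewrite count_map (eq_count (a2 := pred0)) // count_pred0 add0n.
rewrite -[1%N]addn0 iotaDl -map_comp -[in RHS](mkseq_nth 0%N nu); congr sumn.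
apply: eq_map => i /=; rewrite count_map (eq_count (a2 := predT)) //.
by rewrite count_predT size_iota.
Qed.

Lemma eta_sumE n lam : is_partition n lam ->
  exists2 c : algC, 0 < c & eta n lam 1 = c * ratr (eta_sum n lam).
Proof.
move=> pl; exists ((chi n lam 1%g)^-1 * (n`!)%:R).
  rewrite mulr_gt0 ?ltr0n ?fact_gt0 // invr_gt0 chiE //.
  by have /irrP[i ->] := specht_char_irr (leqnn n) pl; apply: irr1_gt0.
rewrite /eta sum_fixing_chi // -mulrA; congr (_ * (_ * _)).
rewrite /eta_sum rmorph_sum; apply: eq_bigr => j _.
by rewrite !rmorphM rmorphXn rmorphN1 fmorphV !rmorph_nat.
Qed.

Theorem theorem1p3 (n : nat) (lam : seq nat) :
  (2 <= n)%N -> is_partition n lam ->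
  [/\ (* (a) *)
      eta n lam 1 = 0 <->
        lam = [:: (n - 1)%N; 1%N] \/ lam = 2%N :: nseq (n - 2) 1%N,
      (* (b) *)
      size lam = 1%N -> lam <> [:: 2%N] -> 0 < eta n lam 1
    & (* (c) *)
      (2 <= size lam)%N ->
      lam <> [:: (n - 1)%N; 1%N] -> lam <> 2%N :: nseq (n - 2) 1%N ->
        sign (eta n lam 1) = (-1) ^+ (sumn lam - head 0%N lam - 1)
        /\ (-1) ^+ (sumn lam - head 0%N lam - 1)
           = (-1) ^+ (cells_under_first_row lam - 1) :> int].
Proof.
move=> n2 pl; have [c c0 ->] := eta_sumE pl.
have zero_eta : (c * ratr (eta_sum n lam) = 0) <-> (eta_sum n lam = 0).
  split=> [/eqP|->]; last by rewrite rmorph0 mulr0.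
  by rewrite mulf_eq0 (gt_eqF c0) fmorph_eq0 => /eqP.
have e := sumn_partition pl.
case: lam pl e zero_eta => [|L nu] pl e zero_eta; first by rewrite -e in n2.
have [s l0 _] := is_partitionP _ _ pl; have L0 : (0 < L)%N := l0 0%N isT.
have hL : (nth 0%N nu 0 <= L)%N := s 0%N.
have pn : is_partition (n - L) nu.
  apply/is_partitionP; split=> [i|i il|]; [exact: (s i.+1)|exact: (l0 i.+1)|].
  by rewrite -e /= addKn.
case nE : (n - L)%N pn => [|m] pn.
  have nu0 := is_partition0 pn; rewrite {}nu0 /= in e zero_eta *.
  have nL : n = L by rewrite -e addn0.
  rewrite nL in n2 zero_eta *; split=> //; last first.
    move=> _ L2; rewrite mulr_gt0 // ltr0q eta_sum_row //.
    by rewrite ltn_neqAle n2 andbT; apply/eqP => L2'; rewrite -L2' in L2.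
  (* Among the one-row shapes only (2) has eigenvalue zero; it is [2 :: nseq (n - 2) 1] at n = 2. *)
  split=> [/zero_eta|[//|[L2 _]]].
    case: (ltnP 2 L) => [/eta_sum_row /gt_eqF/eqP //|L2 _]; right.
    by have -> : L = 2%N by apply/eqP; rewrite eqn_leq L2 n2.
  apply/zero_eta; rewrite L2 /eta_sum !big_ord_recl big_ord0.
  have := strip_below_nil (i := 1) (L := 2) isT isT.
  have := strip_below_nil (i := 2) (L := 2) isT isT.
  by rewrite /strip_below !add0n => -> ->.
have nLm : n = (L + m.+1)%N by lia.
have exc : ((nu == [:: 1%N]) || ((L == 2%N) && (nu == nseq m.+1 1%N))) <->
    L :: nu = [:: (n - 1)%N; 1%N] \/ L :: nu = 2%N :: nseq (n - 2) 1%N.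
  split=> [/orP[/eqP e1|/andP[/eqP L2 /eqP e1]]|[[_ ->]|[L2 ->]]].
  - by left; congr cons => //; move: e; rewrite e1 /=; lia.
  - by right; rewrite nLm L2 addKn e1.
  - by rewrite eqxx.
  - by rewrite nLm L2 addKn !eqxx orbT.
have := eta_sum_sign pn hL; rewrite -nLm; case: ifP => [ex E0|nex sg].
  have ex' := exc.1 ex; split=> //.
    by split=> // _; apply/zero_eta.
    by case: (nu) pn.
  by move=> _ n1 n2'; case: ex' => [/n1|/n2'].
have nex' : ~ (L :: nu = [:: (n - 1)%N; 1%N] \/ L :: nu = 2%N :: nseq (n - 2) 1%N).
  by move/exc.2; rewrite nex.
split.
- split=> // /zero_eta E0; by rewrite E0 mulr0 ltxx in sg.
- by case: (nu) pn.
move=> _ _ _; rewrite cells_under_first_rowE /= (sumn_partition pn) addKn subn1 /=; split=> //.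
rewrite /sign pmulr_rgt0 // pmulr_rlt0 // ltr0q ltrq0.
move: sg; rewrite -signr_odd -[RHS]signr_odd; case: (odd m) => /=.
  by rewrite expr1 mulN1r oppr_gt0 => sg; rewrite ltNge (ltW sg) sg.
by rewrite expr0 mul1r => ->.
Qed.
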